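(* Let $\{u_s^{n}\}_{n\ge0}$ be generated by the sETDMs2 scheme (defined in the context) with initial datum $u_s^0=u(0)$. Assume that $u(0)$ has $H_h^2(\Omega)$-regularity and $A\ge\frac{2+\sqrt3}{6}$. Then the numerical solution satisfies the global in time bounds $$E_{\mathcal N}(u_s^{n+1})\le E_{\mathcal N}(u_s^0),\qquad \|u_s^{n+1}(t)\|_{H_h^2}^2\le C_1\ \ (t\in[0,t_{n+1}]),\qquad 0\le n\le N_t-1,$$ where the constant $C_1$ depends only on $\varepsilon$, $\Omega$ and $\|u(0)\|_{H_h^2}$.
   Context: Setting: $\Omega=[0,L]^2$, $\varepsilon>0$ and $T>0$ are constants, $N$ and $N_t$ are positive integers, $h=\frac{L}{2N}$, $\tau=\frac{T}{N_t}$, $t_n=n\tau$. Grid points are $(x_i,y_j)=(ih,jh)$, $0\le i,j\le 2N$. $\mathcal{M}^{\mathcal N}$ is the space of 2D periodic grid functions on this grid. For $f\in\mathcal M^{\mathcal N}$ put, for $-N+1\le k,l\le N$, $(\hat f_c)_{k,l}=\frac{1}{4N^2}\sum_{i,j=1}^{2N} f(x_i,y_j)\exp(-\frac{2\pi \mathrm{i}}{L}(kx_i+ly_j))$. Discrete derivative: $(D_xf)_{i,j}=\sum_{k,l=-N+1}^{N}\frac{2k\pi \mathrm{i}}{L}(\hat f_c)_{k,l}\exp(\frac{2\pi \mathrm{i}}{L}(kx_i+ly_j))$, $(D_x^2f)_{i,j}=\sum_{k,l=-N+1}^{N}-\frac{4k^2\pi^2}{L^2}(\hat f_c)_{k,l}\exp(\frac{2\pi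 \mathrm{i}}{L}(kx_i+ly_j))$, and $D_y,D_y^2$ similarly. Set $\nabla_{\mathcal N}f=(D_xf,D_yf)^T$, $\nabla_{\mathcal N}\cdot(f^1,f^2)^T=D_xf^1+D_yf^2$, $\Delta_{\mathcal N}=D_x^2+D_y^2$. Inner product and norms: grid functions may take complex values, $(f,g)_{\mathcal N}=h^2\sum_{i,j=1}^{2N}f_{ij}\overline{g_{ij}}$, $\|f\|_{\mathcal N}=\sqrt{(f,f)_{\mathcal N}}$, and $\|f\|_{H_h^2}=\big(\sum_{|\alpha|\le2}\|D_x^{\alpha_1}D_y^{\alpha_2}f\|_{\mathcal N}^2\big)^{1/2}$. $\mathcal M_0^{\mathcal N}=\{v\in\mathcal M^{\mathcal N}: (v,1)_{\mathcal N}=0\}$. For a vector $\mathbf v$, $|\mathbf v|$ is its Euclidean norm (modulus), pointwise on the grid. ''$u(0)$ has $H_h^2$-regularity'' means that $\|u(0)\|_{H^2_h}$ is finite; the point is that $C_1$ is independent of $h$, $\tau$, $n$ and $T$. Nonlinear term: $f_{\mathcal N}(v)=\nabla_{\mathcal N}\cdot\left(\frac{\nabla_{\mathcal N}v}{1+|\nabla_{\mathcal N}v|^2}\right)$, and $f_{\mathcal N,L}(s,v,w)=f_{\mathcal N}(v)+\frac{s}{\tau}[f_{\mathcal N}(v)-f_{\mathcal N}(w)]$ for $s\in[0,\tau]$. Discrete energy: $E_{\mathcal N}(v)=\left(-\frac12\ln(1+|\nabla_{\mathcal N}v|^2),1\right)_{\mathcal N}+\frac{\varepsilon^2}{2}\|\Delta_{\mathcal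 N}v\|_{\mathcal N}^2$. sETDMs2 scheme (with constant $A>0$): $u_s^0=u(0)\in\mathcal M_0^{\mathcal N}$ is the given initial grid function. The initial step is the (continuous) function $u_s^1:[0,t_1]\to\mathcal M_0^{\mathcal N}$ with $u_s^1(0)=u_s^0$ and $$\frac{\mathrm d u_s^1(t)}{\mathrm dt}+A\tau^2\frac{\mathrm d\,\Delta_{\mathcal N}^2u_s^1(t)}{\mathrm dt}=-\varepsilon^2\Delta_{\mathcal N}^2u_s^1(t)-f_{\mathcal N}(u_s^0),\quad t\in(0,t_1].$$ For $n\ge1$, $u_s^{n+1}:[0,t_{n+1}]\to\mathcal M_0^{\mathcal N}$ is the continuous function with $u_s^{n+1}(t)=u_s^n(t)$ on $[0,t_n]$ and $$\frac{\mathrm d u_s^{n+1}(t)}{\mathrm dt}+A\tau^2\frac{\mathrm d\,\Delta_{\mathcal N}^2u_s^{n+1}(t)}{\mathrm dt}=-\varepsilon^2\Delta_{\mathcal N}^2u_s^{n+1}(t)-f_{\mathcal N,L}(t-t_n,u_s^n,u_s^{n-1}),\quad t\in(t_n,t_{n+1}],$$ where, written without a time argument, $u_s^{n}$ denotes the value $u_s^{n}(t_{n})$. *)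

(* Defs.v *)
From Stdlib Require Import Reals ZArith.
From Coquelicot Require Import Coquelicot.

Open Scope R_scope.

(** A grid function is stored as its extension to all of Z x Z; the value at
    [i j] is the value at (x_i, y_j) = (i h, j h).  Membership in the space of
    periodic grid functions is [periodic] below. *)
Definition grid_fun := Z -> Z -> C.

Definition periodic (N : nat) (f : grid_fun) : Prop :=
  forall i j : Z,
    f (i + 2 * Z.of_nat N)%Z j = f i j /\ f i (j + 2 * Z.of_nat N)%Z = f i j.

Definition mesh (L : R) (N : nat) : R := L / (2 * INR N).

(** Sum over the grid indices 1 <= i, j <= 2N. *)
Definition grid_sum (N : nat) (F : Z -> Z -> C) : C :=
  sum_n_m (fun i => sum_n_m (fun j => F (Z.of_nat i) (Z.of_nat j))
                            1 (2 * N)) 1 (2 * N).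

(** Sum over the frequencies -N+1 <= k, l <= N. *)
Definition freq_sum (N : nat) (F : Z -> Z -> C) : C :=
  grid_sum N (fun k l => F (k - Z.of_nat N)%Z (l - Z.of_nat N)%Z).

(** exp (i theta). *)
Definition expi (theta : R) : C := (cos theta, sin theta).

Definition phase (L : R) (N : nat) (k l i j : Z) : R :=
  2 * PI / L * (IZR k * (IZR i * mesh L N) + IZR l * (IZR j * mesh L N)).

Definition dft (L : R) (N : nat) (f : grid_fun) (k l : Z) : C :=
  (RtoC (1 / (4 * INR N ^ 2)) *
   grid_sum N (fun i j => f i j * expi (- phase L N k l i j)))%C.

(** Fourier multiplier with symbol [m]. *)
Definition multiplier (L : R) (N : nat) (m : Z -> Z -> C) (f : grid_fun)
  : grid_fun :=
  fun i j =>
    freq_sum N (fun k l => m k l * dft L N f k l * expi (phase L N k l i j))%C.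

Definition Dx (L : R) (N : nat) : grid_fun -> grid_fun :=
  multiplier L N (fun k _ => RtoC (2 * IZR k * PI / L) * Ci)%C.
Definition Dy (L : R) (N : nat) : grid_fun -> grid_fun :=
  multiplier L N (fun _ l => RtoC (2 * IZR l * PI / L) * Ci)%C.
Definition Dxx (L : R) (N : nat) : grid_fun -> grid_fun :=
  multiplier L N (fun k _ => RtoC (- (4 * IZR k ^ 2 * PI ^ 2 / L ^ 2))).
Definition Dyy (L : R) (N : nat) : grid_fun -> grid_fun :=
  multiplier L N (fun _ l => RtoC (- (4 * IZR l ^ 2 * PI ^ 2 / L ^ 2))).

Definition divergence (L : R) (N : nat) (f1 f2 : grid_fun) : grid_fun :=
  fun i j => (Dx L N f1 i j + Dy L N f2 i j)%C.

Definition laplacian (L : R) (N : nat) (f : grid_fun) : grid_fun :=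
  fun i j => (Dxx L N f i j + Dyy L N f i j)%C.

Definition bilaplacian (L : R) (N : nat) (f : grid_fun) : grid_fun :=
  laplacian L N (laplacian L N f).

Definition inner (L : R) (N : nat) (f g : grid_fun) : C :=
  (RtoC (mesh L N ^ 2) * grid_sum N (fun i j => f i j * Cconj (g i j)))%C.

(** [inner L N f f] is real and nonnegative, so taking [Re] loses nothing. *)
Definition normN (L : R) (N : nat) (f : grid_fun) : R :=
  sqrt (Re (inner L N f f)).

Definition normH2 (L : R) (N : nat) (f : grid_fun) : R :=
  sqrt (normN L N f ^ 2
        + normN L N (Dx L N f) ^ 2
        + normN L N (Dy L N f) ^ 2
        + normN L N (Dxx L N f) ^ 2
        + normN L N (Dx L N (Dy L N f)) ^ 2
        + normN L N (Dyy L N f) ^ 2).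

Definition const_grid (c : C) : grid_fun := fun _ _ => c.

Definition mean_zero_grid (L : R) (N : nat) (f : grid_fun) : Prop :=
  periodic N f /\ inner L N f (const_grid (RtoC 1)) = RtoC 0.

(** Pointwise Euclidean norm of the discrete gradient. *)
Definition grad_mod (L : R) (N : nat) (v : grid_fun) (i j : Z) : R :=
  sqrt (Cmod (Dx L N v i j) ^ 2 + Cmod (Dy L N v i j) ^ 2).

Definition fN (L : R) (N : nat) (v : grid_fun) : grid_fun :=
  divergence L N
    (fun i j => Dx L N v i j / RtoC (1 + grad_mod L N v i j ^ 2))%C
    (fun i j => Dy L N v i j / RtoC (1 + grad_mod L N v i j ^ 2))%C.

Definition fNL (L : R) (N : nat) (tau s : R) (v w : grid_fun) : grid_fun :=
  fun i j =>
    (fN L N v i j + RtoC (s / tau) * (fN L N v i j - fN L N w i j))%C.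

(** The logarithmic grid function is real, hence so is its inner product
    with 1. *)
Definition energy (L : R) (N : nat) (eps : R) (v : grid_fun) : R :=
  Re (inner L N
        (fun i j => RtoC (- (1 / 2) * ln (1 + grad_mod L N v i j ^ 2)))
        (const_grid (RtoC 1)))
  + eps ^ 2 / 2 * normN L N (laplacian L N v) ^ 2.

(** [g], regarded as a function on [0,b] only, has derivative [d] at [t]: this
    is [is_derive] with the neighbourhoods of [t] traced on [0,b], so that it
    is the left derivative at t = b. *)
Definition is_derive_upto (b : R) (g : R -> C) (t : R) (d : C) : Prop :=
  @filterdiff R_AbsRing R_NormedModule C_R_NormedModule
    g (within (fun s => 0 <= s <= b) (locally t)) (fun y => scal y d).

(** [w] is a continuous map from [0,b] to the mean-zero grid functions. *)
Definition continuous_path (L : R) (N : nat) (b : R) (w : R -> grid_fun)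
  : Prop :=
  (forall t : R, 0 <= t <= b -> mean_zero_grid L N (w t)) /\
  (forall i j : Z, continuous_on (fun s => 0 <= s <= b) (fun s => w s i j)).

(** On (a,b],  dw/dt + A tau^2 d(Delta^2 w)/dt = - eps^2 Delta^2 w - F(t). *)
Definition solves_on (L : R) (N : nat) (eps A tau a b : R)
    (w F : R -> grid_fun) : Prop :=
  forall t : R, a < t <= b -> forall i j : Z,
    exists d1 d2 : C,
      is_derive_upto b (fun s => w s i j) t d1 /\
      is_derive_upto b (fun s => bilaplacian L N (w s) i j) t d2 /\
      (d1 + RtoC (A * tau ^ 2) * d2
       = - (RtoC (eps ^ 2) * bilaplacian L N (w t) i j) - F t i j)%C.

(** [u n] is the function on [0, n tau] with upper index n (only its values
    there matter), so [u n (t n)] is u_s^n written without a time argument;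
    [u 0] matters at time 0 only, where it is the initial datum. *)
Definition sETDMs2 (L : R) (N : nat) (eps A T : R) (Nt : nat)
    (u0 : grid_fun) (u : nat -> R -> grid_fun) : Prop :=
  let tau := T / INR Nt in
  let t := fun n : nat => INR n * tau in
  mean_zero_grid L N u0 /\
  u 0%nat (t 0%nat) = u0 /\
  (continuous_path L N (t 1%nat) (u 1%nat) /\
   u 1%nat 0 = u0 /\
   solves_on L N eps A tau 0 (t 1%nat) (u 1%nat) (fun _ => fN L N u0)) /\
  (forall n : nat, (1 <= n < Nt)%nat ->
     continuous_path L N (t (S n)) (u (S n)) /\
     (forall r : R, 0 <= r <= t n -> u (S n) r = u n r) /\
     solves_on L N eps A tau (t n) (t (S n)) (u (S n))
       (fun r => fNL L N tau (r - t n) (u n (t n)) (u (n - 1)%nat (t (n - 1)%nat)))).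

(* Main.v *)
Require Import Defs.
From Stdlib Require Import Reals ZArith Lra Lia.
From Coquelicot Require Import Coquelicot.
(* [Rderiv] has a [Dx] of its own. *)
Import Defs.

Open Scope R_scope.

(** Write v = u^n, v' = u^(n-1), y(t) for the Fourier coefficient of the
    current solution at a mode (k, l), and lam for minus the symbol of the
    discrete Laplacian there.

    The equation is a stabilised gradient flow of the energy E: the
    L^2-gradient of E is f_N(u) + eps^2 Delta^2 u, and in the scheme f_N(u)
    is replaced by its extrapolation f_N(v) + (s/tau)(f_N(v) - f_N(v')).
    Two pointwise facts about the saturation g(p) = p / (1 + |p|^2) control
    the nonlinearity.

    - The potential -ln(1 + |p|^2)/2 lies below its tangent plus |q - p|^2/2
      ([log_semiconvex]).  Summed over the grid and combined with the
      summation by parts [flux_divergence], this bounds E(u(t)) by E(v), plus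
      a quantity which is quadratic and diagonal in Fourier space, plus half
      the squared distance of the gradients of u(t) and v
      ([energy_tangent]).
    - g is 1-Lipschitz ([saturation_lipschitz]), so the error of the
      extrapolation is controlled by the squared distance of the gradients of
      v and v' ([flux_lipschitz]).

    Since the scheme is linear in the unknown, each Fourier mode obeys a
    scalar linear differential equation ([mode_equation]), and the energy
    estimate is proved mode by mode.  For each mode a Lyapunov function with a
    time-dependent weight on |y(t) - y(t_n)|^2 is nonincreasing on a time step
    ([mode_decay]).  The destabilising terms are absorbed by the
    regularisation, through 1 + A tau^2 lam^2 >= 2 sqrt(A) tau lam and
    the lower bound on A ([mode_rate_nonpos]).  Summing over
    the modes gives ([step_energy])

      E(u(t)) + 1/2 |grad (u(t) - v)|^2 <= E(v) + 1/2 |grad (v - v')|^2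

    for all t in the step.  With t the end of the step this telescopes, and
    the initial step fits with v' = v, so E(u(t)) <= E(u(0)) at all times.

    Finally E controls the H^2 norm: the logarithm grows more slowly than any
    multiple of |grad u|^2, which by the spectral gap of mean-zero functions
    is dominated by eps^2 |Delta u|^2 ([energy_coercive]). *)

(* The carrier of a sum over the additive monoid of [C] or [R] is only
   convertible to [C] or [R], whereas [ring] recognises its type
   syntactically. *)
Ltac cring := match goal with |- ?a = ?b => change (@eq C a b); ring end.
Ltac eq_R := match goal with |- ?a = ?b => change (@eq R a b) end.
Ltac rring := eq_R; ring.

(** * Double sums *)

(** Extensionality, monotonicity, positivity and additivity of sums are all
    instances of this transfer principle. *)
Lemma sum_n_m_rel {G H : AbelianMonoid} (Rel : G -> H -> Prop)
    (a : nat -> G) (b : nat -> H) (n m : nat) :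
  Rel zero zero ->
  (forall x y x' y', Rel x x' -> Rel y y' -> Rel (plus x y) (plus x' y')) ->
  (forall k, (n <= k <= m)%nat -> Rel (a k) (b k)) ->
  Rel (sum_n_m a n m) (sum_n_m b n m).
Proof.
  intros H0 Hp Hk.
  induction m as [|m IH].
  - destruct (Nat.eq_dec n 0) as [->|Hn].
    + rewrite !sum_n_n. apply Hk; lia.
    + rewrite !sum_n_m_zero by lia. exact H0.
  - destruct (le_lt_dec n (S m)) as [Hle|Hlt].
    + rewrite !sum_n_Sm by exact Hle. apply Hp; [apply IH; intros k ?|]; apply Hk; lia.
    + rewrite !sum_n_m_zero by lia. exact H0.
Qed.

Lemma sum_n_m_swap {G : AbelianMonoid} (a : nat -> nat -> G) (n m n' m' : nat) :
  sum_n_m (fun i => sum_n_m (fun j => a i j) n' m') n m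
  = sum_n_m (fun j => sum_n_m (fun i => a i j) n m) n' m'.
Proof.
  induction m as [|m IH].
  - destruct (Nat.eq_dec n 0) as [->|Hn].
    + rewrite sum_n_n. apply sum_n_m_ext; intros j. now rewrite sum_n_n.
    + rewrite sum_n_m_zero by lia. symmetry. rewrite <- (sum_n_m_const_zero n' m').
      apply sum_n_m_ext; intros j. apply sum_n_m_zero; lia.
  - destruct (le_lt_dec n (S m)) as [Hle|Hlt].
    + rewrite sum_n_Sm, IH, <- sum_n_m_plus by exact Hle.
      apply sum_n_m_ext; intros j. now rewrite sum_n_Sm.
    + rewrite sum_n_m_zero by lia. symmetry. rewrite <- (sum_n_m_const_zero n' m').
      apply sum_n_m_ext; intros j. apply sum_n_m_zero; lia.
Qed.

Definition gsum {G : AbelianMonoid} (N : nat) (F : Z -> Z -> G) : G :=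
  sum_n_m (fun i => sum_n_m (fun j => F (Z.of_nat i) (Z.of_nat j))
                            1 (2 * N)) 1 (2 * N).

Definition fsum {G : AbelianMonoid} (N : nat) (F : Z -> Z -> G) : G :=
  gsum N (fun k l => F (k - Z.of_nat N)%Z (l - Z.of_nat N)%Z).

Definition on_grid (N : nat) (i j : Z) : Prop :=
  (1 <= i <= 2 * Z.of_nat N)%Z /\ (1 <= j <= 2 * Z.of_nat N)%Z.

Definition in_band (N : nat) (k l : Z) : Prop :=
  (- Z.of_nat N + 1 <= k <= Z.of_nat N)%Z /\
  (- Z.of_nat N + 1 <= l <= Z.of_nat N)%Z.

Lemma gsum_rel {G H : AbelianMonoid} (Rel : G -> H -> Prop) (N : nat)
    (a : Z -> Z -> G) (b : Z -> Z -> H) :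
  Rel zero zero ->
  (forall x y x' y', Rel x x' -> Rel y y' -> Rel (plus x y) (plus x' y')) ->
  (forall i j, on_grid N i j -> Rel (a i j) (b i j)) ->
  Rel (gsum N a) (gsum N b).
Proof.
  intros H0 Hp Hk. unfold gsum.
  apply sum_n_m_rel; auto. intros i Hi.
  apply sum_n_m_rel; auto. intros j Hj.
  apply Hk. unfold on_grid. lia.
Qed.

Lemma fsum_rel {G H : AbelianMonoid} (Rel : G -> H -> Prop) (N : nat)
    (a : Z -> Z -> G) (b : Z -> Z -> H) :
  Rel zero zero ->
  (forall x y x' y', Rel x x' -> Rel y y' -> Rel (plus x y) (plus x' y')) ->
  (forall k l, in_band N k l -> Rel (a k l) (b k l)) ->
  Rel (fsum N a) (fsum N b).
Proof.
  intros H0 Hp Hk. unfold fsum.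
  apply gsum_rel; auto. intros i j Hij.
  apply Hk. unfold in_band, on_grid in *. lia.
Qed.

Lemma gsum_ext {G : AbelianMonoid} (N : nat) (a b : Z -> Z -> G) :
  (forall i j, on_grid N i j -> a i j = b i j) -> gsum N a = gsum N b.
Proof.
  intros H. apply (gsum_rel eq); auto. now intros x y x' y' -> ->.
Qed.

Lemma fsum_ext {G : AbelianMonoid} (N : nat) (a b : Z -> Z -> G) :
  (forall k l, in_band N k l -> a k l = b k l) -> fsum N a = fsum N b.
Proof.
  intros H. apply (fsum_rel eq); auto. now intros x y x' y' -> ->.
Qed.

Lemma gsum_additive {G H : AbelianMonoid} (phi : G -> H) (N : nat)
    (a : Z -> Z -> G) :
  phi zero = zero ->
  (forall x y, phi (plus x y) = plus (phi x) (phi y)) ->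
  phi (gsum N a) = gsum N (fun i j => phi (a i j)).
Proof.
  intros H0 Hp. apply (gsum_rel (fun x y => phi x = y)); auto.
  intros x y x' y' <- <-. apply Hp.
Qed.

Lemma fsum_additive {G H : AbelianMonoid} (phi : G -> H) (N : nat)
    (a : Z -> Z -> G) :
  phi zero = zero ->
  (forall x y, phi (plus x y) = plus (phi x) (phi y)) ->
  phi (fsum N a) = fsum N (fun k l => phi (a k l)).
Proof. intros H0 Hp. unfold fsum. now apply gsum_additive. Qed.

Lemma gsum_plus {G : AbelianMonoid} (N : nat) (a b : Z -> Z -> G) :
  gsum N (fun i j => plus (a i j) (b i j)) = plus (gsum N a) (gsum N b).
Proof.
  unfold gsum. rewrite <- sum_n_m_plus.
  apply sum_n_m_ext; intros i. apply sum_n_m_plus.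
Qed.

Lemma gsum_swap {G : AbelianMonoid} (N : nat) (a : Z -> Z -> Z -> Z -> G) :
  gsum N (fun i j => gsum N (fun k l => a i j k l))
  = gsum N (fun k l => gsum N (fun i j => a i j k l)).
Proof.
  unfold gsum.
  transitivity (sum_n_m (fun i => sum_n_m (fun k => sum_n_m (fun j => sum_n_m
    (fun l => a (Z.of_nat i) (Z.of_nat j) (Z.of_nat k) (Z.of_nat l))
    1 (2 * N)) 1 (2 * N)) 1 (2 * N)) 1 (2 * N)).
  { apply sum_n_m_ext; intros i. apply sum_n_m_swap. }
  rewrite sum_n_m_swap. apply sum_n_m_ext; intros k.
  transitivity (sum_n_m (fun i => sum_n_m (fun l => sum_n_m (fun j =>
    a (Z.of_nat i) (Z.of_nat j) (Z.of_nat k) (Z.of_nat l))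
    1 (2 * N)) 1 (2 * N)) 1 (2 * N)).
  { apply sum_n_m_ext; intros i. apply sum_n_m_swap. }
  now rewrite sum_n_m_swap.
Qed.

Lemma gsum_fsum_swap {G : AbelianMonoid} (N : nat) (a : Z -> Z -> Z -> Z -> G) :
  gsum N (fun i j => fsum N (fun k l => a i j k l))
  = fsum N (fun k l => gsum N (fun i j => a i j k l)).
Proof.
  unfold fsum.
  exact (gsum_swap N (fun i j k l => a i j (k - Z.of_nat N)%Z (l - Z.of_nat N)%Z)).
Qed.

Lemma gsum_mult_l (N : nat) (c : C) (a : Z -> Z -> C) :
  gsum N (fun i j => c * a i j)%C = (c * gsum N a)%C.
Proof.
  symmetry. apply (gsum_additive (fun x : C => (c * x)%C)).
  - apply Cmult_0_r.
  - intros x y. apply Cmult_plus_distr_l.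
Qed.

Lemma fsum_mult_l (N : nat) (c : C) (a : Z -> Z -> C) :
  fsum N (fun i j => c * a i j)%C = (c * fsum N a)%C.
Proof. unfold fsum. exact (gsum_mult_l N c _). Qed.

Lemma gsum_Rmult_l (N : nat) (c : R) (a : Z -> Z -> R) :
  gsum N (fun i j => c * a i j) = c * gsum N a.
Proof.
  symmetry. apply (gsum_additive (fun x : R => c * x)).
  - apply Rmult_0_r.
  - intros x y. apply Rmult_plus_distr_l.
Qed.

Lemma fsum_Rmult_l (N : nat) (c : R) (a : Z -> Z -> R) :
  fsum N (fun i j => c * a i j) = c * fsum N a.
Proof. unfold fsum. exact (gsum_Rmult_l N c _). Qed.

Lemma gsum_Rplus (N : nat) (a b : Z -> Z -> R) :
  gsum N (fun i j => a i j + b i j) = gsum N a + gsum N b.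
Proof. exact (gsum_plus N a b). Qed.

Lemma fsum_Rplus (N : nat) (a b : Z -> Z -> R) :
  fsum N (fun i j => a i j + b i j) = fsum N a + fsum N b.
Proof. exact (gsum_plus N _ _). Qed.

Lemma gsum_le (N : nat) (a b : Z -> Z -> R) :
  (forall i j, on_grid N i j -> a i j <= b i j) -> gsum N a <= gsum N b.
Proof.
  intros H. apply (gsum_rel Rle); auto.
  - apply Rle_refl.
  - intros x y x' y' ? ?. now apply Rplus_le_compat.
Qed.

Lemma fsum_le (N : nat) (a b : Z -> Z -> R) :
  (forall k l, in_band N k l -> a k l <= b k l) -> fsum N a <= fsum N b.
Proof.
  intros H. apply (fsum_rel Rle); auto.
  - apply Rle_refl.
  - intros x y x' y' ? ?. now apply Rplus_le_compat.
Qed.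

Lemma fsum_nonneg (N : nat) (a : Z -> Z -> R) :
  (forall k l, in_band N k l -> 0 <= a k l) -> 0 <= fsum N a.
Proof.
  intros H. apply (fsum_rel (fun x _ => 0 <= x) N a a); auto.
  - apply Rle_refl.
  - intros x y x' y' ? ?. now apply Rplus_le_le_0_compat.
Qed.

Lemma gsum_Rconst (N : nat) (c : R) : gsum N (fun _ _ => c) = 4 * INR N ^ 2 * c.
Proof.
  unfold gsum. rewrite sum_n_m_const, sum_n_m_const.
  replace (S (2 * N) - 1)%nat with (2 * N)%nat by lia.
  rewrite mult_INR. simpl. ring.
Qed.

Lemma Re_gsum (N : nat) (a : Z -> Z -> C) :
  Re (gsum N a) = gsum N (fun i j => Re (a i j)).
Proof. now apply (gsum_additive Re). Qed.

Lemma Re_fsum (N : nat) (a : Z -> Z -> C) :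
  Re (fsum N a) = fsum N (fun i j => Re (a i j)).
Proof. now apply (fsum_additive Re). Qed.

Lemma Cconj_fsum (N : nat) (a : Z -> Z -> C) :
  Cconj (fsum N a) = fsum N (fun i j => Cconj (a i j)).
Proof.
  apply (fsum_additive Cconj).
  - unfold Cconj. simpl. now rewrite Ropp_0.
  - intros x y. apply Cplus_conj.
Qed.

(** * Discrete Fourier analysis *)

Lemma expi_plus (a b : R) : expi (a + b) = (expi a * expi b)%C.
Proof.
  unfold expi, Cmult. simpl. rewrite cos_plus, sin_plus. f_equal; ring.
Qed.

Lemma expi_opp (a : R) : expi (- a) = Cconj (expi a).
Proof. unfold expi, Cconj. simpl. now rewrite cos_neg, sin_neg. Qed.

Lemma Cconj_RtoC (x : R) : Cconj (RtoC x) = RtoC x.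
Proof. unfold Cconj, RtoC. simpl. now rewrite Ropp_0. Qed.

Lemma expi_0 : expi 0 = RtoC 1.
Proof. unfold expi. now rewrite cos_0, sin_0. Qed.

Lemma expi_2PI_nat (n : nat) : expi (2 * PI * INR n) = RtoC 1.
Proof.
  unfold expi. rewrite <- (Rplus_0_l (2 * PI * INR n)).
  replace (2 * PI * INR n) with (2 * INR n * PI) by ring.
  now rewrite cos_period, sin_period, cos_0, sin_0.
Qed.

Lemma expi_2PI_Z (n : Z) : expi (2 * PI * IZR n) = RtoC 1.
Proof.
  destruct (Z_le_gt_dec 0 n) as [H|H].
  - rewrite <- (Z2Nat.id n H), <- INR_IZR_INZ. apply expi_2PI_nat.
  - replace n with (- Z.of_nat (Z.to_nat (- n)))%Z by lia.
    rewrite opp_IZR, <- INR_IZR_INZ, Ropp_mult_distr_r_reverse, expi_opp,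
      expi_2PI_nat.
    apply Cconj_RtoC.
Qed.

Lemma expi_neq_1 (x : R) : 0 < Rabs x < 2 * PI -> expi x <> RtoC 1.
Proof.
  intros [H0 H1] E. assert (Ec : cos (Rabs x) = 1).
  { unfold Rabs; destruct (Rcase_abs x).
    - rewrite cos_neg. now injection E.
    - now injection E. }
  replace (Rabs x) with (2 * (Rabs x / 2)) in Ec by lra.
  rewrite cos_2a_sin in Ec.
  assert (0 < sin (Rabs x / 2)) by (apply sin_gt_0; lra).
  nra.
Qed.

(** Multiplying by the ratio permutes the terms cyclically, so the sum is
    fixed by a factor different from 1. *)
Lemma sum_expi_zero (M : nat) (d : Z) :
  (0 < M)%nat -> d <> 0%Z -> (Z.abs d < Z.of_nat M)%Z ->
  sum_n_m (fun i => expi (2 * PI * IZR d * INR i / INR M)) 1 M = RtoC 0.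
Proof.
  intros HM Hd0 Hd.
  assert (HM' : 0 < INR M) by (apply lt_0_INR; lia).
  set (a := fun i => expi (2 * PI * IZR d * INR i / INR M)).
  set (om := expi (2 * PI * IZR d / INR M)).
  assert (Hstep : forall i, (om * a i)%C = a (S i)).
  { intros i. unfold om, a. rewrite <- expi_plus. f_equal. rewrite S_INR.
    field. lra. }
  assert (Hcyc : (om * sum_n_m a 1 M)%C = sum_n_m a 1 M).
  { change (mult om (sum_n_m a 1 M) = sum_n_m a 1 M).
    rewrite <- (@sum_n_m_mult_l C_Ring om a).
    rewrite (sum_n_m_ext _ (fun i => a (S i))) by exact Hstep.
    rewrite sum_n_m_S.
    rewrite (sum_n_Sm a 2 M) by lia.
    rewrite (sum_Sn_m a 1 M) by lia.
    rewrite plus_comm. f_equal. unfold a.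
    rewrite S_INR.
    replace (2 * PI * IZR d * (INR M + 1) / INR M)
      with (2 * PI * IZR d + 2 * PI * IZR d * INR 1 / INR M)
      by (simpl; field; lra).
    rewrite expi_plus, expi_2PI_Z. apply Cmult_1_l. }
  assert (Hom : om <> RtoC 1).
  { apply expi_neq_1.
    assert (HR : 0 < Rabs (IZR d)) by (apply Rabs_pos_lt; now apply not_0_IZR).
    assert (HR' : Rabs (IZR d) < INR M).
    { rewrite <- abs_IZR, INR_IZR_INZ. now apply IZR_lt. }
    assert (HP := PI_RGT_0).
    unfold Rdiv. rewrite !Rabs_mult, (Rabs_pos_eq (/ INR M)), (Rabs_pos_eq 2),
      (Rabs_pos_eq PI) by (try lra; left; now apply Rinv_0_lt_compat).
    split.
    - apply Rmult_lt_0_compat; [nra | now apply Rinv_0_lt_compat].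
    - apply (Rmult_lt_reg_r (INR M)); auto.
      rewrite Rmult_assoc, Rinv_l by lra. nra. }
  assert (Hz : ((om - 1) * sum_n_m a 1 M = 0)%C).
  { unfold Cminus. rewrite Cmult_plus_distr_r, Hcyc. ring. }
  assert (Hom' : (om - 1)%C <> RtoC 0).
  { intros E. apply Hom. replace om with ((om - 1) + 1)%C by ring.
    rewrite E. ring. }
  change (sum_n_m a 1 M = RtoC 0).
  replace (sum_n_m a 1 M) with (/ (om - 1) * ((om - 1) * sum_n_m a 1 M))%C
    by (rewrite Cmult_assoc, Cinv_l by exact Hom'; apply Cmult_1_l).
  rewrite Hz. apply Cmult_0_r.
Qed.

Lemma sum_n_m_single {G : AbelianMonoid} (a : nat -> G) (n m k0 : nat) :
  (n <= k0 <= m)%nat ->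
  (forall k, (n <= k <= m)%nat -> k <> k0 -> a k = zero) ->
  sum_n_m a n m = a k0.
Proof.
  intros Hk Hz. induction m as [|m IH].
  - assert (k0 = 0%nat) as -> by lia. assert (n = 0%nat) as -> by lia. apply sum_n_n.
  - rewrite sum_n_Sm by lia. destruct (Nat.eq_dec k0 (S m)) as [->|Hne].
    + rewrite (sum_n_m_ext_loc a (fun _ => zero)) by (intros k ?; apply Hz; lia).
      rewrite sum_n_m_const_zero. apply plus_zero_l.
    + rewrite IH by (try lia; intros k ? ?; apply Hz; lia).
      rewrite (Hz (S m)) by lia. apply plus_zero_r.
Qed.

(** The form in which orthogonality of the characters collapses a double sum. *)
Lemma gsum_single {G : AbelianMonoid} (N : nat) (a : Z -> Z -> G) (i0 j0 : Z) :
  on_grid N i0 j0 ->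
  (forall i j, on_grid N i j -> i <> i0 \/ j <> j0 -> a i j = zero) ->
  gsum N a = a i0 j0.
Proof.
  unfold on_grid. intros H Hz. unfold gsum.
  rewrite (sum_n_m_single _ 1 (2 * N) (Z.to_nat i0)) by
    (try lia; intros i Hi Hne; rewrite <- (sum_n_m_const_zero 1 (2 * N));
     apply sum_n_m_ext_loc; intros j Hj; apply Hz; lia).
  rewrite (sum_n_m_single _ 1 (2 * N) (Z.to_nat j0)) by
    (try lia; intros j Hj Hne; apply Hz; lia).
  now rewrite !Z2Nat.id by lia.
Qed.

Lemma fsum_single {G : AbelianMonoid} (N : nat) (a : Z -> Z -> G) (k0 l0 : Z) :
  in_band N k0 l0 ->
  (forall k l, in_band N k l -> k <> k0 \/ l <> l0 -> a k l = zero) ->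
  fsum N a = a k0 l0.
Proof.
  unfold in_band. intros H Hz. unfold fsum.
  rewrite (gsum_single N _ (k0 + Z.of_nat N) (l0 + Z.of_nat N)).
  - f_equal; lia.
  - unfold on_grid; lia.
  - unfold on_grid. intros i j Hij Hne. apply Hz; lia.
Qed.

Section Fourier.

Context (L : R) (N : nat) (HL : 0 < L) (HN : (1 <= N)%nat).

Let N_pos : 0 < INR N.
Proof. apply lt_0_INR. lia. Qed.

Lemma phase_eq (k l i j : Z) :
  phase L N k l i j
  = 2 * PI * IZR k * IZR i / INR (2 * N) + 2 * PI * IZR l * IZR j / INR (2 * N).
Proof.
  unfold phase, mesh. rewrite mult_INR. simpl (INR 2). field. lra.
Qed.

Lemma phase_minus_l (k l k' l' i j : Z) :
  phase L N (k - k') (l - l') i j = phase L N k l i j + - phase L N k' l' i j.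
Proof. unfold phase. rewrite !minus_IZR. ring. Qed.

Lemma phase_sym (k l i j : Z) : phase L N k l i j = phase L N i j k l.
Proof. unfold phase. ring. Qed.

Lemma gsum_expi_zero (p q : Z) :
  (p <> 0 \/ q <> 0)%Z ->
  (Z.abs p < 2 * Z.of_nat N)%Z -> (Z.abs q < 2 * Z.of_nat N)%Z ->
  gsum N (fun i j => expi (phase L N p q i j)) = RtoC 0.
Proof.
  intros Hpq Hp Hq.
  set (e := fun (d : Z) (i : nat) => expi (2 * PI * IZR d * INR i / INR (2 * N))).
  transitivity (Cmult (sum_n_m (e p) 1 (2 * N)) (sum_n_m (e q) 1 (2 * N))).
  - unfold gsum.
    change (Cmult (sum_n_m (e p) 1 (2 * N)) (sum_n_m (e q) 1 (2 * N))) with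
      (@mult C_Ring (sum_n_m (e p) 1 (2 * N)) (sum_n_m (e q) 1 (2 * N))).
    rewrite <- (@sum_n_m_mult_r C_Ring).
    apply sum_n_m_ext; intros i. rewrite <- (@sum_n_m_mult_l C_Ring).
    apply sum_n_m_ext; intros j. rewrite phase_eq, expi_plus, <- !INR_IZR_INZ.
    reflexivity.
  - destruct Hpq as [H|H].
    + unfold e. rewrite (sum_expi_zero (2 * N) p) by lia. apply Cmult_0_l.
    + unfold e. rewrite (sum_expi_zero (2 * N) q) by lia. apply Cmult_0_r.
Qed.

Lemma expi_phase_0 (k l : Z) : expi (phase L N k l 0 0) = RtoC 1.
Proof.
  rewrite <- expi_0. f_equal. unfold phase. ring.
Qed.

Lemma gsum_expi_0 : gsum N (fun i j => expi (phase L N 0 0 i j)) = RtoC (4 * INR N ^ 2).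
Proof.
  transitivity (gsum N (fun _ _ => RtoC 1)).
  { apply gsum_ext; intros i j _. rewrite phase_sym. apply expi_phase_0. }
  rewrite <- (gsum_additive RtoC N (fun _ _ => 1)).
  - now rewrite gsum_Rconst, Rmult_1_r.
  - reflexivity.
  - apply RtoC_plus.
Qed.

(** The frequency window is a translate of the grid window, so summing over
    frequencies differs from summing over grid points by a unimodular factor:
    one orthogonality relation serves both directions of the transform. *)
Lemma fsum_expi (p q : Z) :
  fsum N (fun k l => expi (phase L N k l p q))
  = (Cconj (expi (phase L N (Z.of_nat N) (Z.of_nat N) p q))
     * gsum N (fun i j => expi (phase L N p q i j)))%C.
Proof.
  unfold fsum. rewrite <- gsum_mult_l. apply gsum_ext; intros k l _.
  rewrite phase_minus_l, Rplus_comm, expi_plus, expi_opp.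
  now rewrite (phase_sym k l).
Qed.

Let card_inv : (RtoC (1 / (4 * INR N ^ 2)) * RtoC (4 * INR N ^ 2))%C = RtoC 1.
Proof. rewrite <- RtoC_mult. f_equal. field. lra. Qed.

(** A trigonometric polynomial with frequencies in the window has the
    expected coefficients, because two distinct frequencies of the window
    differ by less than the period 2N. *)
Lemma dft_synthesis (a : Z -> Z -> C) (k l : Z) :
  in_band N k l ->
  dft L N (fun i j => fsum N (fun k l => a k l * expi (phase L N k l i j))%C) k l
  = a k l.
Proof.
  intros Hkl. unfold dft. change grid_sum with (@gsum C_AbelianMonoid).
  transitivity (RtoC (1 / (4 * INR N ^ 2)) *
    fsum N (fun k' l' => a k' l' *
      gsum N (fun i j => expi (phase L N (k' - k) (l' - l) i j))))%C.
  - f_equal. transitivity (gsum N (fun i j => fsum N (fun k' l' =>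
      a k' l' * expi (phase L N (k' - k) (l' - l) i j))%C)).
    + apply gsum_ext; intros i j _. rewrite Cmult_comm, <- fsum_mult_l.
      apply fsum_ext; intros k' l' _. rewrite phase_minus_l, expi_plus. cring.
    + rewrite gsum_fsum_swap. apply fsum_ext; intros k' l' _. apply gsum_mult_l.
  - rewrite (fsum_single N _ k l Hkl).
    + rewrite !Z.sub_diag, gsum_expi_0.
      rewrite (Cmult_comm (a k l)), Cmult_assoc, card_inv. apply Cmult_1_l.
    + intros k' l' Hkl' Hne. unfold in_band in *.
      rewrite gsum_expi_zero by lia. apply Cmult_0_r.
Qed.

Lemma dft_inversion (f : grid_fun) (i j : Z) :
  on_grid N i j ->
  fsum N (fun k l => dft L N f k l * expi (phase L N k l i j))%C = f i j.
Proof.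
  intros Hij. unfold dft. change grid_sum with (@gsum C_AbelianMonoid).
  transitivity (RtoC (1 / (4 * INR N ^ 2)) *
    gsum N (fun i' j' => f i' j' *
      fsum N (fun k l => expi (phase L N k l (i - i') (j - j')))))%C.
  - rewrite <- gsum_mult_l.
    transitivity (fsum N (fun k l => gsum N (fun i' j' =>
      RtoC (1 / (4 * INR N ^ 2)) *
      (f i' j' * expi (phase L N k l (i - i') (j - j'))))%C)).
    + apply fsum_ext; intros k l _.
      rewrite gsum_mult_l, <- Cmult_assoc. f_equal.
      rewrite Cmult_comm, <- gsum_mult_l.
      apply gsum_ext; intros i' j' _.
      rewrite (phase_sym k l (i - i')), phase_minus_l, expi_plus.
      rewrite (phase_sym i j k l), (phase_sym i' j' k l). cring.
    + rewrite <- gsum_fsum_swap. apply gsum_ext; intros i' j' _.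
      rewrite fsum_mult_l. f_equal. now rewrite fsum_mult_l.
  - rewrite (gsum_single N _ i j Hij).
    + rewrite fsum_expi, !Z.sub_diag, gsum_expi_0.
      rewrite expi_phase_0, Cconj_RtoC, Cmult_1_l.
      rewrite (Cmult_comm (f i j)), Cmult_assoc, card_inv. apply Cmult_1_l.
    + intros i' j' Hij' Hne. unfold on_grid in *.
      rewrite fsum_expi, gsum_expi_zero by lia.
      now rewrite !Cmult_0_r.
Qed.

Theorem plancherel (f g : grid_fun) :
  inner L N f g
  = (RtoC (L ^ 2) * fsum N (fun k l => dft L N f k l * Cconj (dft L N g k l)))%C.
Proof.
  unfold inner. change grid_sum with (@gsum C_AbelianMonoid).
  transitivity (RtoC (mesh L N ^ 2) * gsum N (fun i j => fsum N (fun k l =>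
    Cconj (dft L N g k l) * (f i j * expi (- phase L N k l i j)))))%C.
  - f_equal. apply gsum_ext; intros i j Hij.
    rewrite <- (dft_inversion g i j Hij) at 1. rewrite Cconj_fsum, <- fsum_mult_l.
    apply fsum_ext; intros k l _. rewrite Cmult_conj, expi_opp. cring.
  - rewrite gsum_fsum_swap, <- !fsum_mult_l. apply fsum_ext; intros k l _.
    rewrite gsum_mult_l. unfold dft at 2. change grid_sum with (@gsum C_AbelianMonoid).
    replace (mesh L N ^ 2) with (L ^ 2 * (1 / (4 * INR N ^ 2)))
      by (unfold mesh; field; lra).
    rewrite RtoC_mult. cring.
Qed.

Lemma dft_multiplier (m : Z -> Z -> C) (f : grid_fun) (k l : Z) :
  in_band N k l -> dft L N (multiplier L N m f) k l = (m k l * dft L N f k l)%C.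
Proof.
  intros H. exact (dft_synthesis (fun k l => m k l * dft L N f k l)%C k l H).
Qed.

Lemma dft_additive (f g : grid_fun) (k l : Z) :
  dft L N (fun i j => f i j + g i j)%C k l = (dft L N f k l + dft L N g k l)%C.
Proof.
  unfold dft. change grid_sum with (@gsum C_AbelianMonoid).
  rewrite <- Cmult_plus_distr_l. f_equal.
  rewrite <- (gsum_plus (G := C_AbelianMonoid) N).
  apply gsum_ext; intros i j _. apply Cmult_plus_distr_r.
Qed.

Lemma dft_scal (c : C) (f : grid_fun) (k l : Z) :
  dft L N (fun i j => c * f i j)%C k l = (c * dft L N f k l)%C.
Proof.
  unfold dft. change grid_sum with (@gsum C_AbelianMonoid).
  rewrite Cmult_assoc, (Cmult_comm c), <- Cmult_assoc. f_equal.
  rewrite <- gsum_mult_l. apply gsum_ext; intros i j _. now rewrite Cmult_assoc.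
Qed.

Lemma dft_ext (f g : grid_fun) (k l : Z) :
  (forall i j, on_grid N i j -> f i j = g i j) -> dft L N f k l = dft L N g k l.
Proof.
  intros H. unfold dft. change grid_sum with (@gsum C_AbelianMonoid). f_equal.
  apply gsum_ext; intros i j Hij. now rewrite H.
Qed.

Lemma dft_minus (f g : grid_fun) (k l : Z) :
  dft L N (fun i j => f i j - g i j)%C k l = (dft L N f k l - dft L N g k l)%C.
Proof.
  rewrite (dft_ext _ (fun i j => f i j + (-(1)) * g i j)%C) by (intros; cring).
  rewrite dft_additive, dft_scal. cring.
Qed.

End Fourier.

(** * Pointwise estimates for the logarithmic potential *)

Lemma ln_le_minus_1 (x : R) : 0 < x -> ln x <= x - 1.
Proof.
  intros Hx. rewrite <- (ln_exp (x - 1)).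
  assert (H := exp_ineq1_le (x - 1)).
  destruct (Rle_lt_or_eq_dec x (exp (x - 1))) as [Hlt|Heq]; [lra| |].
  - left. now apply ln_increasing.
  - rewrite <- Heq. apply Rle_refl.
Qed.

(** From ln x <= x - 1 at x = (1 + P) / (1 + Q). *)
Lemma ln_sub_ge (P Q : R) :
  0 <= P -> 0 <= Q -> (Q - P) / (1 + Q) <= ln (1 + Q) - ln (1 + P).
Proof.
  intros HP HQ.
  assert (H := ln_le_minus_1 ((1 + P) / (1 + Q))).
  rewrite ln_div in H by lra.
  assert (0 < (1 + P) / (1 + Q)) by (apply Rdiv_lt_0_compat; lra).
  replace ((Q - P) / (1 + Q)) with (1 - (1 + P) / (1 + Q)) by (field; lra).
  lra.
Qed.

(** The scalar content of [log_semiconvex]: P and Q are the squared norms of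
    two vectors and S is their inner product.  After [ln_sub_ge] and clearing
    denominators, Cauchy-Schwarz gives (Q - P)^2 <= |q - p|^2 |q + p|^2, and
    what remains is |q - p|^2 times a positive quantity. *)
Lemma log_semiconvex_aux (P Q S : R) :
  0 <= P -> 0 <= Q -> S ^ 2 <= P * Q ->
  - (1 / 2) * ln (1 + Q)
  <= - (1 / 2) * ln (1 + P) - (S - P) / (1 + P) + (P + Q - 2 * S) / 2.
Proof.
  intros HP HQ HS.
  assert (Hln := ln_sub_ge P Q HP HQ).
  assert (HPQ : 0 <= P * Q) by now apply Rmult_le_pos.
  assert (HS1 : 2 * S <= 1 + P * Q) by (assert (0 <= (S - 1) ^ 2) by apply pow2_ge_0; nra).
  assert (HS2 : 2 * S <= P + Q).
  { apply Rsqr_incr_0_var; [|lra]. unfold Rsqr.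
    assert (0 <= (P - Q) ^ 2) by apply pow2_ge_0. nra. }
  assert (Hsq : (Q - P) ^ 2 <= (P + Q - 2 * S) * (P + Q + 2 * S)) by nra.
  assert (Hpoly : 0 <= (Q - P) * (1 + P) - 2 * (S - P) * (1 + Q)
                       + (P + Q - 2 * S) * ((1 + P) * (1 + Q))).
  { assert (0 <= (P + Q - 2 * S) * (2 + Q + P * Q - 2 * S))
      by (apply Rmult_le_pos; lra).
    nra. }
  assert (Hfrac : (Q - P) / (1 + Q) - 2 * (S - P) / (1 + P) + (P + Q - 2 * S)
    = ((Q - P) * (1 + P) - 2 * (S - P) * (1 + Q)
       + (P + Q - 2 * S) * ((1 + P) * (1 + Q))) * / ((1 + P) * (1 + Q)))
    by (field; lra).
  assert (0 <= (Q - P) / (1 + Q) - 2 * (S - P) / (1 + P) + (P + Q - 2 * S)).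
  { rewrite Hfrac. apply Rmult_le_pos; [exact Hpoly|].
    left. apply Rinv_0_lt_compat. nra. }
  lra.
Qed.

Definition Cdot (a b : C) : R := Re (a * Cconj b)%C.

Lemma Cdot_eq (a b : C) : Cdot a b = Re a * Re b + Im a * Im b.
Proof. unfold Cdot, Re, Im. simpl. ring. Qed.

Lemma Cdiv_RtoC (a : C) (x : R) :
  x <> 0 -> (a / RtoC x)%C = (Re a * / x, Im a * / x).
Proof.
  intros Hx. unfold Cdiv. rewrite <- RtoC_inv by exact Hx.
  unfold RtoC, Cmult, Re, Im. simpl. apply f_equal2; ring.
Qed.

(** The Hessian of -ln(1 + |p|^2)/2 is at most 1/8, so the deviation from
    the tangent plane is within the constant 1/2, for which an elementary
    inequality is enough. *)
Lemma log_semiconvex (p1 p2 q1 q2 : C) :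
  let P := Cmod p1 ^ 2 + Cmod p2 ^ 2 in
  let Q := Cmod q1 ^ 2 + Cmod q2 ^ 2 in
  - (1 / 2) * ln (1 + Q)
  <= - (1 / 2) * ln (1 + P)
     - (Cdot (p1 / RtoC (1 + P)) (q1 - p1) + Cdot (p2 / RtoC (1 + P)) (q2 - p2))
     + 1 / 2 * (Cmod (q1 - p1) ^ 2 + Cmod (q2 - p2) ^ 2).
Proof.
  intros P Q.
  assert (HP : 0 <= P) by (unfold P; nra).
  assert (HQ : 0 <= Q) by (unfold Q; nra).
  rewrite !Cdiv_RtoC by lra. rewrite !Cdot_eq.
  eapply Rle_trans; [apply (log_semiconvex_aux P Q (Cdot p1 q1 + Cdot p2 q2)); auto|].
  - rewrite !Cdot_eq. unfold P, Q. rewrite !Cmod2_alt.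
    destruct p1 as [a b], p2 as [c d], q1 as [a' b'], q2 as [c' d']. simpl.
    assert (0 <= (a * b' - b * a') ^ 2) by apply pow2_ge_0.
    assert (0 <= (a * c' - c * a') ^ 2) by apply pow2_ge_0.
    assert (0 <= (a * d' - d * a') ^ 2) by apply pow2_ge_0.
    assert (0 <= (b * c' - c * b') ^ 2) by apply pow2_ge_0.
    assert (0 <= (b * d' - d * b') ^ 2) by apply pow2_ge_0.
    assert (0 <= (c * d' - d * c') ^ 2) by apply pow2_ge_0.
    lra.
  - apply Req_le. rewrite !Cdot_eq, !Cmod2_alt.
    assert (HPe : P = Re p1 ^ 2 + Im p1 ^ 2 + (Re p2 ^ 2 + Im p2 ^ 2))
      by (unfold P; now rewrite !Cmod2_alt).
    assert (HQe : Q = Re q1 ^ 2 + Im q1 ^ 2 + (Re q2 ^ 2 + Im q2 ^ 2))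
      by (unfold Q; now rewrite !Cmod2_alt).
    clear HP HQ.
    clearbody P Q.
    destruct p1 as [a b], p2 as [c d], q1 as [a' b'], q2 as [c' d'].
    simpl in *. subst Q.
    replace (a * a' + b * b' + (c * c' + d * d') - P) with
      (a * (a' - a) + b * (b' - b) + (c * (c' - c) + d * (d' - d)))
      by (rewrite HPe; ring).
    set (w := ln (1 + P)). unfold Rdiv. set (r := / (1 + P)). clearbody w r.
    rewrite HPe. field.
Qed.

(** p / (1 + |p|^2) is the gradient of ln(1 + |p|^2)/2, whose Hessian has its
    eigenvalues in [-1/8, 1]. *)
Lemma saturation_lipschitz (p1 p2 q1 q2 : C) :
  let P := Cmod p1 ^ 2 + Cmod p2 ^ 2 in
  let Q := Cmod q1 ^ 2 + Cmod q2 ^ 2 in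
  Cmod (p1 / RtoC (1 + P) - q1 / RtoC (1 + Q)) ^ 2
  + Cmod (p2 / RtoC (1 + P) - q2 / RtoC (1 + Q)) ^ 2
  <= Cmod (p1 - q1) ^ 2 + Cmod (p2 - q2) ^ 2.
Proof.
  intros P Q.
  assert (HP : 0 <= P) by (unfold P; nra).
  assert (HQ : 0 <= Q) by (unfold Q; nra).
  rewrite !Cdiv_RtoC by lra. rewrite !Cmod2_alt.
  assert (HPe : P = Re p1 ^ 2 + Im p1 ^ 2 + (Re p2 ^ 2 + Im p2 ^ 2))
    by (unfold P; now rewrite !Cmod2_alt).
  assert (HQe : Q = Re q1 ^ 2 + Im q1 ^ 2 + (Re q2 ^ 2 + Im q2 ^ 2))
    by (unfold Q; now rewrite !Cmod2_alt).
  clearbody P Q.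
  destruct p1 as [a b], p2 as [c d], q1 as [a' b'], q2 as [c' d']. simpl in *.
  set (u := / (1 + P)). set (v := / (1 + Q)).
  assert (Hu : u * (1 + P) = 1) by (unfold u; field; lra).
  assert (Hv : v * (1 + Q) = 1) by (unfold v; field; lra).
  assert (Hu0 : 0 < u) by (apply Rinv_0_lt_compat; lra).
  assert (Hv0 : 0 < v) by (apply Rinv_0_lt_compat; lra).
  clearbody u v.
  set (D := (a - a') ^ 2 + (b - b') ^ 2 + ((c - c') ^ 2 + (d - d') ^ 2)).
  assert (HD : 0 <= D) by (unfold D; repeat apply Rplus_le_le_0_compat; apply pow2_ge_0).
  (* Polarisation leaves the distance, damped, minus a square. *)
  assert (E : (a * u - a' * v) ^ 2 + (b * u - b' * v) ^ 2
     + ((c * u - c' * v) ^ 2 + (d * u - d' * v) ^ 2)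
     = u * v * D - (u - v) ^ 2).
  { assert (EP : P * u = 1 - u) by lra. assert (EQ : Q * v = 1 - v) by lra.
    transitivity (u * v * D + (P * u) * (u - v) + (Q * v) * (v - u)).
    - unfold D. rewrite HPe, HQe. ring.
    - rewrite EP, EQ. ring. }
  assert (u * v <= 1) by nra.
  assert (u * v * D <= D) by nra.
  assert (0 <= (u - v) ^ 2) by apply pow2_ge_0.
  unfold D in *. simpl in *. lra.
Qed.

(** * Norms and energy in Fourier variables *)

Definition wave (L : R) (k : Z) : R := 2 * IZR k * PI / L.

(** Minus the symbol of the discrete Laplacian. *)
Definition lam (L : R) (k l : Z) : R := wave L k ^ 2 + wave L l ^ 2.

Definition flux_x (L : R) (N : nat) (v : grid_fun) : grid_fun :=
  fun i j => (Dx L N v i j / RtoC (1 + grad_mod L N v i j ^ 2))%C.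

Definition flux_y (L : R) (N : nat) (v : grid_fun) : grid_fun :=
  fun i j => (Dy L N v i j / RtoC (1 + grad_mod L N v i j ^ 2))%C.

Definition gsub (f g : grid_fun) : grid_fun := fun i j => (f i j - g i j)%C.

Definition grad_dist2 (L : R) (N : nat) (f g : grid_fun) : R :=
  normN L N (gsub (Dx L N f) (Dx L N g)) ^ 2
  + normN L N (gsub (Dy L N f) (Dy L N g)) ^ 2.

Lemma lam_nonneg (L : R) (k l : Z) : 0 <= lam L k l.
Proof. unfold lam. apply Rplus_le_le_0_compat; apply pow2_ge_0. Qed.

Lemma Re_mult_conj (z : C) : Re (z * Cconj z)%C = Cmod z ^ 2.
Proof. now rewrite <- Cmod2_conj. Qed.

Lemma Re_scal (x : R) (z : C) : Re (RtoC x * z)%C = x * Re z.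
Proof. unfold Re, RtoC, Cmult. simpl. ring. Qed.

Lemma Im_scal (x : R) (z : C) : Im (RtoC x * z)%C = x * Im z.
Proof. unfold Im, RtoC, Cmult. simpl. ring. Qed.

Lemma Cmod2_imag_scal (a : R) (z : C) :
  Cmod (RtoC a * Ci * z) ^ 2 = a ^ 2 * Cmod z ^ 2.
Proof. rewrite !Cmod2_alt. destruct z as [x y]. simpl. ring. Qed.

Lemma Cmod2_real_scal (a : R) (z : C) : Cmod (RtoC a * z) ^ 2 = a ^ 2 * Cmod z ^ 2.
Proof. rewrite !Cmod2_alt. destruct z as [x y]. simpl. ring. Qed.

Lemma grad_mod_sq (L : R) (N : nat) (v : grid_fun) (i j : Z) :
  grad_mod L N v i j ^ 2 = Cmod (Dx L N v i j) ^ 2 + Cmod (Dy L N v i j) ^ 2.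
Proof.
  unfold grad_mod. rewrite pow2_sqrt; [reflexivity|].
  apply Rplus_le_le_0_compat; apply pow2_ge_0.
Qed.

Section Norms.

Context (L : R) (N : nat) (HL : 0 < L) (HN : (1 <= N)%nat).

Local Notation dft := (dft L N).

Lemma Re_plancherel (f g : grid_fun) :
  Re (inner L N f g) = L ^ 2 * fsum N (fun k l => Cdot (dft f k l) (dft g k l)).
Proof. now rewrite plancherel, Re_scal, Re_fsum by assumption. Qed.

Lemma Re_inner (f g : grid_fun) :
  Re (inner L N f g) = mesh L N ^ 2 * gsum N (fun i j => Cdot (f i j) (g i j)).
Proof.
  unfold inner. change grid_sum with (@gsum C_AbelianMonoid).
  now rewrite Re_scal, Re_gsum.
Qed.

Lemma normN_sq (f : grid_fun) : normN L N f ^ 2 = Re (inner L N f f).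
Proof.
  unfold normN. apply pow2_sqrt. rewrite Re_plancherel.
  apply Rmult_le_pos; [apply pow2_ge_0|]. apply fsum_nonneg; intros k l _.
  unfold Cdot. rewrite Re_mult_conj. apply pow2_ge_0.
Qed.

Lemma normN_dft (f : grid_fun) :
  normN L N f ^ 2 = L ^ 2 * fsum N (fun k l => Cmod (dft f k l) ^ 2).
Proof.
  rewrite normN_sq, Re_plancherel. f_equal. apply fsum_ext; intros k l _.
  apply Re_mult_conj.
Qed.

Lemma normN_grid (f : grid_fun) :
  normN L N f ^ 2 = mesh L N ^ 2 * gsum N (fun i j => Cmod (f i j) ^ 2).
Proof.
  rewrite normN_sq, Re_inner. f_equal. apply gsum_ext; intros i j _.
  apply Re_mult_conj.
Qed.

Lemma dft_Dx (f : grid_fun) (k l : Z) :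
  in_band N k l -> dft (Dx L N f) k l = (RtoC (wave L k) * Ci * dft f k l)%C.
Proof. intros H. now apply dft_multiplier. Qed.

Lemma dft_Dy (f : grid_fun) (k l : Z) :
  in_band N k l -> dft (Dy L N f) k l = (RtoC (wave L l) * Ci * dft f k l)%C.
Proof. intros H. now apply dft_multiplier. Qed.

Lemma dft_Dxx (f : grid_fun) (k l : Z) :
  in_band N k l -> dft (Dxx L N f) k l = (RtoC (- wave L k ^ 2) * dft f k l)%C.
Proof.
  intros H. unfold Dxx. rewrite dft_multiplier by assumption. f_equal. f_equal.
  unfold wave. field. lra.
Qed.

Lemma dft_Dyy (f : grid_fun) (k l : Z) :
  in_band N k l -> dft (Dyy L N f) k l = (RtoC (- wave L l ^ 2) * dft f k l)%C.
Proof.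
  intros H. unfold Dyy. rewrite dft_multiplier by assumption. f_equal. f_equal.
  unfold wave. field. lra.
Qed.

Lemma dft_laplacian (f : grid_fun) (k l : Z) :
  in_band N k l -> dft (laplacian L N f) k l = (RtoC (- lam L k l) * dft f k l)%C.
Proof.
  intros H. unfold laplacian. rewrite dft_additive, dft_Dxx, dft_Dyy by assumption.
  rewrite <- Cmult_plus_distr_r, <- RtoC_plus. do 2 f_equal. unfold lam. ring.
Qed.

Lemma dft_bilaplacian (f : grid_fun) (k l : Z) :
  in_band N k l -> dft (bilaplacian L N f) k l = (RtoC (lam L k l ^ 2) * dft f k l)%C.
Proof.
  intros H. unfold bilaplacian. rewrite !dft_laplacian by assumption.
  rewrite Cmult_assoc, <- RtoC_mult. do 2 f_equal. ring.
Qed.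

Lemma dft_fN (v : grid_fun) (k l : Z) :
  in_band N k l ->
  dft (fN L N v) k l
  = (RtoC (wave L k) * Ci * dft (flux_x L N v) k l
     + RtoC (wave L l) * Ci * dft (flux_y L N v) k l)%C.
Proof.
  intros H. unfold fN, divergence. now rewrite dft_additive, dft_Dx, dft_Dy.
Qed.

Lemma grad_dist2_dft (f g : grid_fun) :
  grad_dist2 L N f g
  = L ^ 2 * fsum N (fun k l => lam L k l * Cmod (dft f k l - dft g k l) ^ 2).
Proof.
  unfold grad_dist2. rewrite !normN_dft, <- Rmult_plus_distr_l, <- fsum_Rplus.
  f_equal. apply fsum_ext; intros k l H. unfold gsub.
  rewrite !dft_minus, !dft_Dx, !dft_Dy by assumption.
  assert (E : forall x : R, (RtoC x * Ci * dft f k l - RtoC x * Ci * dft g k l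
     = RtoC x * Ci * (dft f k l - dft g k l))%C) by (intros; ring).
  rewrite !E, !Cmod2_imag_scal. unfold lam. rring.
Qed.

Lemma grad_dist2_grid (f g : grid_fun) :
  grad_dist2 L N f g
  = mesh L N ^ 2 * gsum N (fun i j =>
      Cmod (Dx L N f i j - Dx L N g i j) ^ 2
      + Cmod (Dy L N f i j - Dy L N g i j) ^ 2).
Proof.
  unfold grad_dist2. now rewrite !normN_grid, <- Rmult_plus_distr_l, <- gsum_Rplus.
Qed.

Lemma grad_dist2_nonneg (f g : grid_fun) : 0 <= grad_dist2 L N f g.
Proof. unfold grad_dist2. apply Rplus_le_le_0_compat; apply pow2_ge_0. Qed.

Lemma grad_dist2_refl (f : grid_fun) : grad_dist2 L N f f = 0.
Proof.
  rewrite grad_dist2_dft. rewrite (fsum_ext N _ (fun _ _ => 0 * 0)).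
  - rewrite fsum_Rmult_l. rring.
  - intros k l _. unfold Cminus. rewrite Cplus_opp_r, Cmod_0. rring.
Qed.

Lemma normN_laplacian (f : grid_fun) :
  normN L N (laplacian L N f) ^ 2
  = L ^ 2 * fsum N (fun k l => lam L k l ^ 2 * Cmod (dft f k l) ^ 2).
Proof.
  rewrite normN_dft. f_equal. apply fsum_ext; intros k l H.
  rewrite dft_laplacian by assumption. rewrite Cmod2_real_scal. rring.
Qed.

(** Plancherel carries the pointwise Lipschitz bound over to the Fourier
    coefficients of the flux, where the mode-by-mode estimate needs it. *)
Lemma flux_lipschitz (v w : grid_fun) :
  L ^ 2 * fsum N (fun k l =>
     Cmod (dft (flux_x L N v) k l - dft (flux_x L N w) k l) ^ 2
     + Cmod (dft (flux_y L N v) k l - dft (flux_y L N w) k l) ^ 2)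
  <= grad_dist2 L N v w.
Proof.
  transitivity (normN L N (gsub (flux_x L N v) (flux_x L N w)) ^ 2
                + normN L N (gsub (flux_y L N v) (flux_y L N w)) ^ 2).
  { apply Req_le. rewrite !normN_dft, <- Rmult_plus_distr_l, <- fsum_Rplus.
    f_equal. apply fsum_ext; intros k l H. unfold gsub. now rewrite !dft_minus. }
  rewrite !normN_grid, <- Rmult_plus_distr_l, <- gsum_Rplus, grad_dist2_grid.
  apply Rmult_le_compat_l; [apply pow2_ge_0|]. apply gsum_le; intros i j _.
  unfold gsub, flux_x, flux_y. rewrite !grad_mod_sq. apply saturation_lipschitz.
Qed.

Lemma energy_eq (eps : R) (v : grid_fun) :
  energy L N eps v
  = mesh L N ^ 2 * gsum N (fun i j => - (1 / 2) * ln (1 + grad_mod L N v i j ^ 2))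
    + eps ^ 2 / 2 * normN L N (laplacian L N v) ^ 2.
Proof.
  unfold energy. rewrite Re_inner. do 2 f_equal. apply gsum_ext; intros i j _.
  unfold Cdot, const_grid. rewrite Re_scal, Cconj_RtoC. simpl. rring.
Qed.

(** Summation by parts: the symbols of Dx and Dy are imaginary. *)
Lemma flux_divergence (v w : grid_fun) :
  mesh L N ^ 2 * gsum N (fun i j =>
    Cdot (flux_x L N v i j) (Dx L N w i j - Dx L N v i j)
    + Cdot (flux_y L N v i j) (Dy L N w i j - Dy L N v i j))
  = - (L ^ 2 * fsum N (fun k l => Cdot (dft (fN L N v) k l) (dft w k l - dft v k l))).
Proof.
  transitivity (Re (inner L N (flux_x L N v) (gsub (Dx L N w) (Dx L N v)))
    + Re (inner L N (flux_y L N v) (gsub (Dy L N w) (Dy L N v)))).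
  { now rewrite gsum_Rplus, Rmult_plus_distr_l, !Re_inner. }
  rewrite !Re_plancherel, <- Rmult_plus_distr_l, <- fsum_Rplus.
  rewrite Ropp_mult_distr_r. f_equal.
  replace (- fsum N (fun k l => Cdot (dft (fN L N v) k l) (dft w k l - dft v k l)))
    with (-1 * fsum N (fun k l => Cdot (dft (fN L N v) k l) (dft w k l - dft v k l)))
    by (simpl; rring).
  rewrite <- fsum_Rmult_l. apply fsum_ext; intros k l H.
  unfold gsub. rewrite !dft_minus, !dft_Dx, !dft_Dy, dft_fN by assumption.
  rewrite !Cdot_eq.
  destruct (dft (flux_x L N v) k l), (dft (flux_y L N v) k l), (dft w k l),
    (dft v k l). simpl. rring.
Qed.

(** The logarithmic part is compared with its tangent at v; the tangent is
    turned into f_N(v) by [flux_divergence], and the quadratic part is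
    diagonal already. *)
Theorem energy_tangent (eps : R) (v w : grid_fun) :
  energy L N eps w
  <= energy L N eps v
     + L ^ 2 * fsum N (fun k l =>
         Cdot (dft (fN L N v) k l) (dft w k l - dft v k l)
         + eps ^ 2 / 2 * lam L k l ^ 2 * (Cmod (dft w k l) ^ 2 - Cmod (dft v k l) ^ 2))
     + 1 / 2 * grad_dist2 L N w v.
Proof.
  assert (Hlog : mesh L N ^ 2 * gsum N (fun i j =>
      - (1 / 2) * ln (1 + grad_mod L N w i j ^ 2))
    <= mesh L N ^ 2 * gsum N (fun i j => - (1 / 2) * ln (1 + grad_mod L N v i j ^ 2))
       + L ^ 2 * fsum N (fun k l => Cdot (dft (fN L N v) k l) (dft w k l - dft v k l))
       + 1 / 2 * grad_dist2 L N w v).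
  { assert (E := flux_divergence v w).
    assert (H0 : gsum N (fun i j => - (1 / 2) * ln (1 + grad_mod L N w i j ^ 2))
      <= gsum N (fun i j => - (1 / 2) * ln (1 + grad_mod L N v i j ^ 2))
         + -1 * gsum N (fun i j =>
             Cdot (flux_x L N v i j) (Dx L N w i j - Dx L N v i j)
             + Cdot (flux_y L N v i j) (Dy L N w i j - Dy L N v i j))
         + 1 / 2 * gsum N (fun i j =>
             Cmod (Dx L N w i j - Dx L N v i j) ^ 2
             + Cmod (Dy L N w i j - Dy L N v i j) ^ 2)).
    { rewrite <- (gsum_Rmult_l N (-1)), <- (gsum_Rmult_l N (1 / 2)), <- !gsum_Rplus.
      apply gsum_le; intros i j _.
      unfold flux_x, flux_y. rewrite !grad_mod_sq.
      eapply Rle_trans; [apply (log_semiconvex (Dx L N v i j) (Dy L N v i j))|]. apply Req_le. cbv zeta. rring. }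
    apply (Rmult_le_compat_l (mesh L N ^ 2)) in H0; [|apply pow2_ge_0].
    rewrite grad_dist2_grid. simpl in *. lra. }
  rewrite fsum_Rplus, !energy_eq, !normN_laplacian.
  replace (fsum N (fun k l => eps ^ 2 / 2 * lam L k l ^ 2
                     * (Cmod (dft w k l) ^ 2 - Cmod (dft v k l) ^ 2)))
    with (eps ^ 2 / 2 * (fsum N (fun k l => lam L k l ^ 2 * Cmod (dft w k l) ^ 2)
          + -1 * fsum N (fun k l => lam L k l ^ 2 * Cmod (dft v k l) ^ 2))).
  - simpl in *. lra.
  - rewrite <- fsum_Rmult_l, <- fsum_Rplus, <- fsum_Rmult_l.
    apply fsum_ext; intros k l _. simpl. rring.
Qed.

End Norms.

(** * Coercivity of the energy *)

(** The smallest nonzero eigenvalue of the negative discrete Laplacian. *)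
Definition gap (L : R) : R := (2 * PI / L) ^ 2.

Definition log_defect (b : R) : R := b - 1 - ln b.

Lemma gap_pos (L : R) : 0 < L -> 0 < gap L.
Proof.
  intros HL. unfold gap. apply pow_lt. apply Rdiv_lt_0_compat; [|exact HL].
  assert (H := PI_RGT_0). lra.
Qed.

Lemma wave_gap (L : R) (k : Z) : 0 < L -> k <> 0%Z -> gap L <= wave L k ^ 2.
Proof.
  intros HL Hk.
  assert (E : wave L k ^ 2 = IZR k ^ 2 * gap L) by (unfold wave, gap; field; lra).
  assert (Hk2 : 1 <= IZR k ^ 2).
  { rewrite <- Rsqr_pow2, Rsqr_abs, <- abs_IZR, Rsqr_pow2.
    assert (1 <= IZR (Z.abs k)) by (apply IZR_le; lia). nra. }
  assert (Hg := gap_pos L HL). rewrite E. nra.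
Qed.

Section Coercivity.

Context (L : R) (N : nat) (HL : 0 < L) (HN : (1 <= N)%nat).

Let N_pos : 0 < INR N.
Proof. apply lt_0_INR. lia. Qed.

Lemma dft_mean_zero (f : grid_fun) :
  mean_zero_grid L N f -> dft L N f 0 0 = RtoC 0.
Proof.
  intros [_ H]. unfold inner, const_grid in H.
  assert (Hm : RtoC (mesh L N ^ 2) <> RtoC 0).
  { intros E. apply RtoC_inj in E. revert E. apply pow_nonzero.
    unfold mesh. apply Rgt_not_eq. apply Rdiv_lt_0_compat; lra. }
  unfold dft.
  assert (E : grid_sum N (fun i j => f i j * expi (- phase L N 0 0 i j))%C = RtoC 0).
  { transitivity (/ RtoC (mesh L N ^ 2) * (RtoC (mesh L N ^ 2) *
      grid_sum N (fun i j => f i j * expi (- phase L N 0 0 i j))))%C.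
    - rewrite Cmult_assoc, Cinv_l by exact Hm. symmetry. apply Cmult_1_l.
    - rewrite <- (Cmult_0_r (/ RtoC (mesh L N ^ 2))). f_equal. rewrite <- H. f_equal.
      change grid_sum with (@gsum C_AbelianMonoid). apply gsum_ext; intros i j _.
      rewrite Cconj_RtoC. f_equal. rewrite <- expi_0. f_equal.
      unfold phase. ring. }
  rewrite E. apply Cmult_0_r.
Qed.

(** Poincare's inequality, mode by mode: the only mode below the gap is the
    constant one, which is absent. *)
Lemma mode_poincare (f : grid_fun) (k l : Z) :
  mean_zero_grid L N f ->
  gap L * Cmod (dft L N f k l) ^ 2 <= lam L k l * Cmod (dft L N f k l) ^ 2.
Proof.
  intros Hf.
  destruct (Z.eq_dec k 0) as [->|Hk]; [destruct (Z.eq_dec l 0) as [->|Hl]|].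
  - rewrite dft_mean_zero, Cmod_0 by exact Hf. apply Req_le. ring.
  - apply Rmult_le_compat_r; [apply pow2_ge_0|].
    assert (H := wave_gap L l HL Hl). assert (H' := pow2_ge_0 (wave L 0)).
    unfold lam. lra.
  - apply Rmult_le_compat_r; [apply pow2_ge_0|].
    assert (H := wave_gap L k HL Hk). assert (H' := pow2_ge_0 (wave L l)).
    unfold lam. lra.
Qed.

Lemma grad_norm_dft (f : grid_fun) :
  mesh L N ^ 2 * gsum N (fun i j => grad_mod L N f i j ^ 2)
  = L ^ 2 * fsum N (fun k l => lam L k l * Cmod (dft L N f k l) ^ 2).
Proof.
  transitivity (normN L N (Dx L N f) ^ 2 + normN L N (Dy L N f) ^ 2).
  - rewrite !normN_grid, <- Rmult_plus_distr_l, <- gsum_Rplus by assumption.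
    f_equal. apply gsum_ext; intros i j _. apply grad_mod_sq.
  - rewrite !normN_dft, <- Rmult_plus_distr_l, <- fsum_Rplus by assumption.
    f_equal. apply fsum_ext; intros k l H.
    rewrite dft_Dx, dft_Dy, !Cmod2_imag_scal by assumption. unfold lam. rring.
Qed.

Lemma normH2_dft (f : grid_fun) :
  normH2 L N f ^ 2
  = L ^ 2 * fsum N (fun k l =>
      (1 + lam L k l + (wave L k ^ 4 + wave L k ^ 2 * wave L l ^ 2 + wave L l ^ 4))
      * Cmod (dft L N f k l) ^ 2).
Proof.
  unfold normH2. rewrite pow2_sqrt.
  - rewrite !normN_dft, <- !Rmult_plus_distr_l, <- !fsum_Rplus by assumption.
    f_equal. apply fsum_ext; intros k l H.
    rewrite !dft_Dx, !dft_Dxx, !dft_Dyy, !dft_Dy, !Cmod2_imag_scal,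
      !Cmod2_real_scal by assumption.
    unfold lam. rring.
  - repeat apply Rplus_le_le_0_compat; apply pow2_ge_0.
Qed.

Lemma laplacian_le_normH2 (f : grid_fun) :
  normN L N (laplacian L N f) ^ 2 <= 2 * normH2 L N f ^ 2.
Proof.
  rewrite normN_laplacian, normH2_dft by assumption.
  rewrite <- Rmult_assoc, (Rmult_comm 2), Rmult_assoc.
  apply Rmult_le_compat_l; [apply pow2_ge_0|]. rewrite <- fsum_Rmult_l.
  apply fsum_le; intros k l _. rewrite <- Rmult_assoc.
  apply Rmult_le_compat_r; [apply pow2_ge_0|].
  assert (H := lam_nonneg L k l). unfold lam in *.
  assert (0 <= wave L k ^ 2) by apply pow2_ge_0.
  assert (0 <= wave L l ^ 2) by apply pow2_ge_0.
  replace (wave L k ^ 4) with ((wave L k ^ 2) ^ 2) by ring.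
  replace (wave L l ^ 4) with ((wave L l ^ 2) ^ 2) by ring.
  nra.
Qed.

Lemma normH2_le_laplacian (f : grid_fun) :
  mean_zero_grid L N f ->
  normH2 L N f ^ 2
  <= (1 / gap L ^ 2 + 1 / gap L + 1) * normN L N (laplacian L N f) ^ 2.
Proof.
  intros Hf. rewrite normN_laplacian, normH2_dft by assumption.
  rewrite <- Rmult_assoc, (Rmult_comm _ (L ^ 2)), Rmult_assoc.
  apply Rmult_le_compat_l; [apply pow2_ge_0|]. rewrite <- fsum_Rmult_l.
  apply fsum_le; intros k l _.
  assert (H1 := mode_poincare f k l Hf).
  assert (Hl := lam_nonneg L k l). assert (Hg := gap_pos L HL).
  set (c := Cmod (dft L N f k l) ^ 2) in *.
  assert (Hc : 0 <= c) by apply pow2_ge_0.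
  assert (H2 : gap L * (lam L k l * c) <= lam L k l ^ 2 * c) by nra.
  assert (H3 : lam L k l * c <= 1 / gap L * (lam L k l ^ 2 * c)).
  { apply (Rmult_le_reg_l (gap L)); [exact Hg|].
    replace (gap L * (1 / gap L * (lam L k l ^ 2 * c))) with (lam L k l ^ 2 * c)
      by (field; lra). exact H2. }
  assert (H4 : c <= 1 / gap L ^ 2 * (lam L k l ^ 2 * c)).
  { apply (Rmult_le_reg_l (gap L)); [exact Hg|].
    replace (gap L * (1 / gap L ^ 2 * (lam L k l ^ 2 * c)))
      with (1 / gap L * (lam L k l ^ 2 * c)) by (field; lra). lra. }
  assert (H5 : (wave L k ^ 4 + wave L k ^ 2 * wave L l ^ 2 + wave L l ^ 4) * c
               <= lam L k l ^ 2 * c).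
  { apply Rmult_le_compat_r; [exact Hc|]. unfold lam.
    assert (0 <= wave L k ^ 2 * wave L l ^ 2)
      by (apply Rmult_le_pos; apply pow2_ge_0). lra. }
  lra.
Qed.

Lemma mesh_sq_gsum_const (c : R) : mesh L N ^ 2 * gsum N (fun _ _ => c) = L ^ 2 * c.
Proof. rewrite gsum_Rconst. unfold mesh. field. lra. Qed.

(** The slope b is arbitrary; [log_defect b] is the price. *)
Lemma ln_le_affine (b x : R) : 0 < b -> 0 <= x -> ln (1 + x) <= b * x + log_defect b.
Proof.
  intros Hb Hx. unfold log_defect.
  assert (H := ln_le_minus_1 (b * (1 + x))).
  rewrite ln_mult in H by lra.
  assert (0 < b * (1 + x)) by (apply Rmult_lt_0_compat; lra). lra.
Qed.

(** With slope eps^2 gap / 2 in [ln_le_affine], the gradient term is at most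
    half of the bending term by Poincare's inequality. *)
Lemma energy_coercive (eps : R) (f : grid_fun) :
  0 < eps -> mean_zero_grid L N f ->
  eps ^ 2 / 4 * normN L N (laplacian L N f) ^ 2
  <= energy L N eps f + L ^ 2 / 2 * log_defect (eps ^ 2 * gap L / 2).
Proof.
  intros He Hf. set (b := eps ^ 2 * gap L / 2).
  assert (Hg := gap_pos L HL).
  assert (Hb : 0 < b) by (unfold b; assert (0 < eps ^ 2) by nra; nra).
  rewrite energy_eq by assumption.
  assert (H0 : -1 / 2 * b * gsum N (fun i j => grad_mod L N f i j ^ 2)
      + gsum N (fun _ _ => -1 / 2 * log_defect b)
      <= gsum N (fun i j => - (1 / 2) * ln (1 + grad_mod L N f i j ^ 2))).
  { rewrite <- gsum_Rmult_l, <- gsum_Rplus. apply gsum_le; intros i j _.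
    assert (H := ln_le_affine b (grad_mod L N f i j ^ 2) Hb (pow2_ge_0 _)). lra. }
  apply (Rmult_le_compat_l (mesh L N ^ 2)) in H0; [|apply pow2_ge_0].
  rewrite Rmult_plus_distr_l, mesh_sq_gsum_const in H0.
  assert (Hgrad := grad_norm_dft f).
  assert (Hp : gap L * (L ^ 2 * fsum N (fun k l => lam L k l * Cmod (dft L N f k l) ^ 2))
    <= normN L N (laplacian L N f) ^ 2).
  { rewrite normN_laplacian by assumption.
    rewrite <- Rmult_assoc, (Rmult_comm (gap L)), Rmult_assoc.
    apply Rmult_le_compat_l; [apply pow2_ge_0|]. rewrite <- fsum_Rmult_l.
    apply fsum_le; intros k l _.
    assert (H1 := mode_poincare f k l Hf). assert (Hl := lam_nonneg L k l). nra. }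
  rewrite <- Hgrad in Hp.
  apply (Rmult_le_compat_l (eps ^ 2 / 4)) in Hp; [|nra].
  assert (Eb : -1 / 2 * b = - (eps ^ 2 / 4 * gap L)) by (unfold b; field).
  rewrite Eb in H0. simpl in *. lra.
Qed.

Lemma energy_le_normH2 (eps : R) (f : grid_fun) :
  energy L N eps f <= eps ^ 2 * normH2 L N f ^ 2.
Proof.
  rewrite energy_eq by assumption.
  assert (H0 : gsum N (fun i j => - (1 / 2) * ln (1 + grad_mod L N f i j ^ 2))
    <= gsum N (fun _ _ => 0)).
  { apply gsum_le; intros i j _.
    assert (H := ln_sub_ge 0 (grad_mod L N f i j ^ 2) (Rle_refl 0) (pow2_ge_0 _)).
    rewrite Rplus_0_r, ln_1 in H.
    assert (0 <= (grad_mod L N f i j ^ 2 - 0) / (1 + grad_mod L N f i j ^ 2)).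
    { assert (H' := pow2_ge_0 (grad_mod L N f i j)).
      apply Rmult_le_pos; [lra|]. left. apply Rinv_0_lt_compat. lra. }
    lra. }
  apply (Rmult_le_compat_l (mesh L N ^ 2)) in H0; [|apply pow2_ge_0].
  rewrite mesh_sq_gsum_const in H0.
  assert (H1 := laplacian_le_normH2 f).
  apply (Rmult_le_compat_l (eps ^ 2 / 2)) in H1;
    [|assert (H' := pow2_ge_0 eps); lra].
  lra.
Qed.

(** Solves energy <= eps^2 r^2 for the H^2 norm through [energy_coercive] and
    [normH2_le_laplacian]. *)
Definition H2_bound (eps L r : R) : R :=
  (1 / gap L ^ 2 + 1 / gap L + 1)
  * (4 / eps ^ 2 * (eps ^ 2 * r ^ 2 + L ^ 2 / 2 * log_defect (eps ^ 2 * gap L / 2))).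

Theorem normH2_le_of_energy_le (eps : R) (f f0 : grid_fun) :
  0 < eps -> mean_zero_grid L N f ->
  energy L N eps f <= energy L N eps f0 ->
  normH2 L N f ^ 2 <= H2_bound eps L (normH2 L N f0).
Proof.
  intros He Hf HE. assert (Hg := gap_pos L HL).
  assert (He2 : 0 < eps ^ 2) by nra.
  eapply Rle_trans; [apply normH2_le_laplacian, Hf|].
  unfold H2_bound. apply Rmult_le_compat_l.
  - assert (0 < / gap L) by now apply Rinv_0_lt_compat.
    assert (0 < / gap L ^ 2) by (apply Rinv_0_lt_compat; nra).
    unfold Rdiv. lra.
  - assert (H1 := energy_coercive eps f He Hf).
    assert (H2 := energy_le_normH2 eps f0).
    apply (Rmult_le_reg_l (eps ^ 2 / 4)); [lra|].
    rewrite <- (Rmult_assoc (eps ^ 2 / 4) (4 / eps ^ 2)).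
    replace (eps ^ 2 / 4 * (4 / eps ^ 2)) with 1 by (field; lra). lra.
Qed.

End Coercivity.

(** * Decay of a single Fourier mode *)

Lemma nonincreasing_of_derive (f df : R -> R) (a b t : R) :
  a <= t <= b ->
  (forall s, a < s < b -> is_derive f s (df s)) ->
  (forall s, a <= s <= b -> continuous f s) ->
  (forall s, a <= s <= b -> df s <= 0) ->
  f t <= f a.
Proof.
  intros Ht Hd Hc Hn.
  destruct (MVT_gen f a t df) as [c [Hc1 Hc2]].
  - rewrite Rmin_left, Rmax_right by lra. intros s Hs. apply Hd. lra.
  - rewrite Rmin_left, Rmax_right by lra. intros s Hs.
    apply continuity_pt_filterlim. apply Hc. lra.
  - rewrite Rmin_left, Rmax_right in Hc1 by lra.
    assert (H := Hn c). nra.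
Qed.

(** The time derivative of the Lyapunov function of [mode_decay]: d stands for
    y', z for y - y(t_n), and R for the difference of the two values of f_N.
    Both bad terms are absorbed in tau lam |d|^2: by Young's inequality the
    extrapolation term costs 1/2, and the displacement term 16/15, where 15/16
    is the decay rate of the weight.  Their sum stays below 1.57, which
    1 + A tau^2 lam^2 provides. *)
Lemma mode_rate_nonpos (A tau lam gam sig q Rr Ri dr di zr zi : R) :
  (2 + sqrt 3) / 6 <= A -> 0 < tau -> 0 <= lam -> 0 <= sig <= 1 ->
  Rr ^ 2 + Ri ^ 2 <= lam * gam -> 0 <= gam ->
  - (1 + A * tau ^ 2 * lam ^ 2) * (dr ^ 2 + di ^ 2)
  - sig * (Rr * dr + Ri * di)
  + 2 * q * lam * (zr * dr + zi * di)
  - 15 / 16 / tau * q ^ 2 * lam * (zr ^ 2 + zi ^ 2)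
  - gam / (2 * tau) <= 0.
Proof.
  intros HA Htau Hlam Hsig HR Hgam.
  assert (Hs3 : 1.73 <= sqrt 3).
  { rewrite <- (sqrt_pow2 1.73) by lra. apply sqrt_le_1; lra. }
  assert (HA' : 0.6164 <= A) by lra.
  set (n2 := dr ^ 2 + di ^ 2).
  assert (Hn2 : 0 <= n2) by (unfold n2; nra).
  (* 1 + A x^2 >= (1 - 0.785 x)^2 + 1.57 x, since 0.785^2 < 0.6164. *)
  assert (Hstab : 1.57 * tau * lam * n2 <= (1 + A * tau ^ 2 * lam ^ 2) * n2).
  { apply Rmult_le_compat_r; [exact Hn2|].
    assert (0 <= (1 - 0.785 * (tau * lam)) ^ 2) by apply pow2_ge_0.
    assert (0 <= (A - 0.6164) * (tau * lam) ^ 2)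
      by (apply Rmult_le_pos; [lra|apply pow2_ge_0]).
    nra. }
  assert (Hcross : - sig * (Rr * dr + Ri * di) <= tau * lam * n2 / 2 + gam / (2 * tau)).
  { apply (Rmult_le_reg_l (2 * tau)); [lra|].
    replace (2 * tau * (tau * lam * n2 / 2 + gam / (2 * tau)))
      with (tau ^ 2 * lam * n2 + gam) by (field; lra).
    destruct (Rle_lt_or_eq_dec 0 lam Hlam) as [Hpos|<-].
    (* Multiplying by lam makes the bound on R usable. *)
    - apply (Rmult_le_reg_l lam); [exact Hpos|].
      assert (Hsq : 0 <= (sig * Rr + tau * lam * dr) ^ 2 + (sig * Ri + tau * lam * di) ^ 2)
        by (apply Rplus_le_le_0_compat; apply pow2_ge_0).
      assert (Hs2 : sig ^ 2 * (Rr ^ 2 + Ri ^ 2) <= lam * gam).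
      { apply Rle_trans with (1 * (Rr ^ 2 + Ri ^ 2)); [|lra].
        apply Rmult_le_compat_r; [|nra].
        apply Rplus_le_le_0_compat; apply pow2_ge_0. }
      unfold n2. nra.
    - rewrite Rmult_0_l in HR.
      assert (0 <= Rr ^ 2) by apply pow2_ge_0.
      assert (0 <= Ri ^ 2) by apply pow2_ge_0.
      assert (Rr = 0) as -> by nra. assert (Ri = 0) as -> by nra.
      lra. }
  assert (Hyoung : 2 * q * lam * (zr * dr + zi * di)
     <= 16 / 15 * tau * lam * n2 + 15 / 16 / tau * q ^ 2 * lam * (zr ^ 2 + zi ^ 2)).
  { assert (E : 16 / 15 * tau * lam * n2 + 15 / 16 / tau * q ^ 2 * lam * (zr ^ 2 + zi ^ 2)
       - 2 * q * lam * (zr * dr + zi * di)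
       = 15 / 16 / tau * lam * ((q * zr - 16 / 15 * tau * dr) ^ 2
                         + (q * zi - 16 / 15 * tau * di) ^ 2))
      by (unfold n2; field; lra).
    assert (0 <= 15 / 16 / tau * lam * ((q * zr - 16 / 15 * tau * dr) ^ 2
                         + (q * zi - 16 / 15 * tau * di) ^ 2)).
    { apply Rmult_le_pos; [apply Rmult_le_pos|].
      - left. apply Rdiv_lt_0_compat; lra.
      - exact Hlam.
      - apply Rplus_le_le_0_compat; apply pow2_ge_0. }
    lra. }
  assert (0 <= tau * lam * n2)
    by (apply Rmult_le_pos; [apply Rmult_le_pos|]; lra).
  lra.
Qed.

(** Lyapunov function: tangent part of the energy, plus q lam |y - y(t_n)|^2,
    plus a multiple of gam that decreases linearly and pays for the
    extrapolation.  The weight q must satisfy a Riccati inequality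
    q' <= -(15/16) q^2 / tau and end at q = 1, where 1 is the sum of the 1/2
    in [energy_tangent] and the 1/2 that is carried to the next step.  Its
    explicit solution is positive and at least 1 on the whole step. *)
Lemma mode_decay (A tau lam eps gam a t : R) (P Q : C) (yr yi : R -> R) :
  (2 + sqrt 3) / 6 <= A -> 0 < tau -> 0 <= lam -> 0 <= gam ->
  Cmod (P - Q) ^ 2 <= lam * gam ->
  let kk := 1 + A * tau ^ 2 * lam ^ 2 in
  let dr s := - (eps ^ 2 * lam ^ 2 * yr s + Re P + (s - a) / tau * (Re P - Re Q)) / kk in
  let di s := - (eps ^ 2 * lam ^ 2 * yi s + Im P + (s - a) / tau * (Im P - Im Q)) / kk in
  (forall s, a < s < a + tau -> is_derive yr s (dr s)) ->
  (forall s, a < s < a + tau -> is_derive yi s (di s)) ->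
  (forall s, continuous yr s) -> (forall s, continuous yi s) ->
  a <= t <= a + tau ->
  Re P * (yr t - yr a) + Im P * (yi t - yi a)
  + eps ^ 2 / 2 * lam ^ 2 * ((yr t ^ 2 + yi t ^ 2) - (yr a ^ 2 + yi a ^ 2))
  + lam * ((yr t - yr a) ^ 2 + (yi t - yi a) ^ 2) <= gam / 2.
Proof.
  intros HA Htau Hlam Hgam HR kk dr di Hdr Hdi Hcr Hci Ht.
  set (q := fun s => tau / (tau - 15 / 16 * (a + tau - s))).
  set (psi := fun s =>
    Re P * (yr s - yr a) + Im P * (yi s - yi a)
    + eps ^ 2 / 2 * lam ^ 2 * (yr s ^ 2 + yi s ^ 2)
    + q s * (lam * ((yr s - yr a) ^ 2 + (yi s - yi a) ^ 2))
    + (1 - (s - a) / tau) / 2 * gam).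
  assert (Hkk : 0 < kk).
  { unfold kk. assert (0 <= A * tau ^ 2 * lam ^ 2); [|lra].
    assert (0 <= sqrt 3) by apply sqrt_pos.
    apply Rmult_le_pos; [apply Rmult_le_pos; [lra|]|]; apply pow2_ge_0. }
  assert (Hden : forall s, a <= s <= a + tau -> 0 < tau - 15 / 16 * (a + tau - s)).
  { intros s Hs. lra. }
  assert (Hq1 : 1 <= q t).
  { unfold q. apply (Rmult_le_reg_r (tau - 15 / 16 * (a + tau - t))).
    - now apply Hden.
    - unfold Rdiv at 2. rewrite Rmult_assoc, Rinv_l by (apply Rgt_not_eq, Hden, Ht).
      lra. }
  set (dpsi := fun s =>
    Re P * dr s + Im P * di s
    + eps ^ 2 * lam ^ 2 * (yr s * dr s + yi s * di s)
    + (- (15 / 16 / tau) * q s ^ 2 * (lam * ((yr s - yr a) ^ 2 + (yi s - yi a) ^ 2))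
       + q s * (lam * (2 * ((yr s - yr a) * dr s + (yi s - yi a) * di s))))
    - gam / (2 * tau)).
  assert (Hmono : psi t <= psi a).
  { apply (nonincreasing_of_derive psi dpsi a (a + tau)); [exact Ht| | |].
    - intros s Hs. assert (Hr := Hdr s Hs). assert (Hi := Hdi s Hs).
      assert (Hd := Hden s). unfold psi, dpsi, q. auto_derive.
      + repeat split; try lra; eexists; eassumption.
      + apply is_derive_unique in Hr, Hi.
        change (Derive (fun x => yr x) s) with (Derive yr s).
        change (Derive (fun x => yi x) s) with (Derive yi s).
        rewrite Hr, Hi. field. split; lra.
    - intros s Hs. assert (Hd := Hden s Hs). unfold psi, q.
      assert (Hr := Hcr s). assert (Hi := Hci s).
      apply continuity_pt_filterlim in Hr. apply continuity_pt_filterlim in Hi.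
      apply continuity_pt_filterlim.
      unfold Rdiv. simpl. reg. lra.
    - intros s Hs. eapply Rle_trans; [|apply (mode_rate_nonpos A tau lam gam
         ((s - a) / tau) (q s) (Re P - Re Q) (Im P - Im Q) (dr s) (di s)
         (yr s - yr a) (yi s - yi a)); auto].
      + apply Req_le. unfold dpsi.
        assert (Er : Re P + eps ^ 2 * lam ^ 2 * yr s
                     = - kk * dr s - (s - a) / tau * (Re P - Re Q))
          by (unfold dr; field; split; lra).
        assert (Ei : Im P + eps ^ 2 * lam ^ 2 * yi s
                     = - kk * di s - (s - a) / tau * (Im P - Im Q))
          by (unfold di; field; split; lra).
        change (1 + A * tau ^ 2 * lam ^ 2) with kk. clearbody dr di kk.
        transitivity ((Re P + eps ^ 2 * lam ^ 2 * yr s) * dr s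
          + (Im P + eps ^ 2 * lam ^ 2 * yi s) * di s
          + (- (15 / 16 / tau) * q s ^ 2 * (lam * ((yr s - yr a) ^ 2 + (yi s - yi a) ^ 2))
       + q s * (lam * (2 * ((yr s - yr a) * dr s + (yi s - yi a) * di s))))
          - gam / (2 * tau)); [ring|].
        rewrite Er, Ei. ring.
      + split.
        * apply Rmult_le_pos; [lra|]. left. now apply Rinv_0_lt_compat.
        * apply (Rmult_le_reg_r tau); [exact Htau|].
          unfold Rdiv. rewrite Rmult_assoc, Rinv_l by lra. lra.
      + rewrite Cmod2_alt in HR. exact HR. }
  assert (Hz : 0 <= lam * ((yr t - yr a) ^ 2 + (yi t - yi a) ^ 2)).
  { apply Rmult_le_pos; [exact Hlam|].
    apply Rplus_le_le_0_compat; apply pow2_ge_0. }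
  assert (Hqz := Rmult_le_compat_r _ _ _ Hz Hq1). rewrite Rmult_1_l in Hqz.
  assert (Hend : 0 <= (1 - (t - a) / tau) / 2 * gam).
  { apply Rmult_le_pos; [|exact Hgam].
    replace ((1 - (t - a) / tau) / 2) with ((a + tau - t) * / (2 * tau)) by (field; lra).
    apply Rmult_le_pos; [lra|]. left. apply Rinv_0_lt_compat. lra. }
  assert (E0 : psi a = eps ^ 2 / 2 * lam ^ 2 * (yr a ^ 2 + yi a ^ 2) + gam / 2).
  { unfold psi, q. field. lra. }
  rewrite E0 in Hmono. unfold psi in Hmono. lra.
Qed.

(** * Differentiating along a path of grid functions *)

(** At interior times the derivative traced on [0, b] is the ordinary one. *)
Lemma is_derive_of_upto (b : R) (g : R -> C) (t : R) (d : C) :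
  0 < t < b -> is_derive_upto b g t d ->
  is_derive (fun s => Re (g s)) t (Re d) /\ is_derive (fun s => Im (g s)) t (Im d).
Proof.
  intros Ht [Hlin Hdom].
  assert (Hg : filterdiff (K := R_AbsRing) (U := R_NormedModule) (V := C_R_NormedModule)
                 g (locally t) (fun y => scal y d)).
  { split; [exact Hlin|]. intros x Hx.
    apply (is_filter_lim_locally_unique t x) in Hx. subst x.
    intros eps.
    assert (Hw : is_filter_lim (within (fun s => 0 <= s <= b) (locally t)) t).
    { intros P HP. unfold within. now apply (filter_imp P). }
    assert (H := Hdom t Hw eps). unfold within in H.
    assert (Hin : locally t (fun s => 0 <= s <= b)).
    { apply (filter_imp (fun s => 0 < s < b)); [intros s ?; lra|].
      apply open_and; [apply open_gt | apply open_lt | exact Ht]. }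
    generalize (filter_and _ _ H Hin). apply filter_imp. intros s [Hs Hs']. auto. }
  split.
  - apply (filterdiff_ext_lin _ (fun y : R => Re (scal (V := C_R_NormedModule) y d))).
    + apply (filterdiff_comp' g Re t (fun y => scal y d) Re Hg).
      apply filterdiff_linear. apply is_linear_fst.
    + intros y. reflexivity.
  - apply (filterdiff_ext_lin _ (fun y : R => Im (scal (V := C_R_NormedModule) y d))).
    + apply (filterdiff_comp' g Im t (fun y => scal y d) Im Hg).
      apply filterdiff_linear. apply is_linear_snd.
    + intros y. reflexivity.
Qed.

(* A property of real functions of time, such as differentiability at a point
   with a given derivative, passes to finite sums as soon as it is additive. *)
Section Families.

Context (S : (R -> R) -> R -> Prop)
  (S_ext : forall f g d, (forall s, f s = g s) -> S f d -> S g d)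
  (S_zero : S (fun _ => 0) 0)
  (S_plus : forall f g d e, S f d -> S g e -> S (fun s => f s + g s) (d + e)).

Lemma sum_n_m_family (F : nat -> R -> R) (d : nat -> R) (n m : nat) :
  (forall k, (n <= k <= m)%nat -> S (F k) (d k)) ->
  S (fun s => sum_n_m (fun k => F k s) n m) (sum_n_m d n m).
Proof.
  intros Hk. induction m as [|m IH].
  - destruct (Nat.eq_dec n 0) as [->|Hn].
    + rewrite sum_n_n. apply (S_ext (F 0%nat)); [|apply Hk; lia].
      intros s. now rewrite sum_n_n.
    + rewrite sum_n_m_zero by lia. apply (S_ext (fun _ => 0)); [|exact S_zero].
      intros s. now rewrite sum_n_m_zero by lia.
  - destruct (le_lt_dec n (Datatypes.S m)) as [Hle|Hlt].
    + rewrite sum_n_Sm by exact Hle.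
      apply (S_ext (fun s => sum_n_m (fun k => F k s) n m + F (Datatypes.S m) s)).
      * intros s. now rewrite sum_n_Sm.
      * apply S_plus; [apply IH; intros k ?|]; apply Hk; lia.
    + rewrite sum_n_m_zero by lia. apply (S_ext (fun _ => 0)); [|exact S_zero].
      intros s. now rewrite sum_n_m_zero by lia.
Qed.

Lemma gsum_family (N : nat) (F : Z -> Z -> R -> R) (d : Z -> Z -> R) :
  (forall i j, on_grid N i j -> S (F i j) (d i j)) ->
  S (fun s => gsum N (fun i j => F i j s)) (gsum N d).
Proof.
  intros H. unfold gsum.
  apply (sum_n_m_family (fun i s => sum_n_m (fun j => F (Z.of_nat i) (Z.of_nat j) s)
                                      1 (2 * N))).
  intros i Hi.
  apply (sum_n_m_family (fun j => F (Z.of_nat i) (Z.of_nat j))).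
  intros j Hj. apply H. unfold on_grid. lia.
Qed.

End Families.

Lemma Re_dft (L : R) (N : nat) (f : grid_fun) (k l : Z) :
  Re (dft L N f k l) = gsum N (fun i j =>
    Re (f i j) * (1 / (4 * INR N ^ 2) * cos (phase L N k l i j))
    + Im (f i j) * (1 / (4 * INR N ^ 2) * sin (phase L N k l i j))).
Proof.
  unfold dft. change grid_sum with (@gsum C_AbelianMonoid).
  rewrite Re_scal, Re_gsum, <- gsum_Rmult_l. apply gsum_ext; intros i j _.
  unfold expi. rewrite cos_neg, sin_neg. unfold Re, Im, Cmult. simpl. rring.
Qed.

Lemma Im_dft (L : R) (N : nat) (f : grid_fun) (k l : Z) :
  Im (dft L N f k l) = gsum N (fun i j =>
    Re (f i j) * (- (1 / (4 * INR N ^ 2)) * sin (phase L N k l i j))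
    + Im (f i j) * (1 / (4 * INR N ^ 2) * cos (phase L N k l i j))).
Proof.
  unfold dft. change grid_sum with (@gsum C_AbelianMonoid).
  rewrite Im_scal, (gsum_additive Im) by reflexivity.
  rewrite <- gsum_Rmult_l. apply gsum_ext; intros i j _.
  unfold expi. rewrite cos_neg, sin_neg. unfold Re, Im, Cmult. simpl. rring.
Qed.

Lemma is_derive_mult_const (f : R -> R) (t d c : R) :
  is_derive f t d -> is_derive (fun s => f s * c) t (d * c).
Proof.
  intros H. apply (is_derive_ext (fun s => c * f s)); [intros; apply Rmult_comm|].
  rewrite Rmult_comm. now apply (is_derive_scal f t c d).
Qed.

Lemma dft_is_derive (L : R) (N : nat) (f : R -> grid_fun) (d : grid_fun) (t : R)
    (k l : Z) :
  (forall i j, on_grid N i j ->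
     is_derive (fun s => Re (f s i j)) t (Re (d i j)) /\
     is_derive (fun s => Im (f s i j)) t (Im (d i j))) ->
  is_derive (fun s => Re (dft L N (f s) k l)) t (Re (dft L N d k l)) /\
  is_derive (fun s => Im (dft L N (f s) k l)) t (Im (dft L N d k l)).
Proof.
  intros H.
  assert (Hfam : forall (F : Z -> Z -> R -> R) (e : Z -> Z -> R),
    (forall i j, on_grid N i j -> is_derive (F i j) t (e i j)) ->
    is_derive (fun s => gsum N (fun i j => F i j s)) t (gsum N e)).
  { apply (gsum_family (fun g e => is_derive g t e)).
    - intros g h e Hgh. now apply is_derive_ext.
    - apply (is_derive_const (V := R_NormedModule) 0).
    - intros g h e e' Hg Hh. exact (is_derive_plus g h t e e' Hg Hh). }
  split.
  - rewrite Re_dft.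
    apply (is_derive_ext (fun s => gsum N (fun i j =>
      Re (f s i j) * (1 / (4 * INR N ^ 2) * cos (phase L N k l i j))
      + Im (f s i j) * (1 / (4 * INR N ^ 2) * sin (phase L N k l i j)))));
      [intros s; now rewrite Re_dft|].
    apply (Hfam (fun i j s =>
      Re (f s i j) * (1 / (4 * INR N ^ 2) * cos (phase L N k l i j))
      + Im (f s i j) * (1 / (4 * INR N ^ 2) * sin (phase L N k l i j)))).
    intros i j Hij. destruct (H i j Hij) as [Hr Hi].
    apply (is_derive_plus (V := R_NormedModule)); now apply is_derive_mult_const.
  - rewrite Im_dft.
    apply (is_derive_ext (fun s => gsum N (fun i j =>
      Re (f s i j) * (- (1 / (4 * INR N ^ 2)) * sin (phase L N k l i j))
      + Im (f s i j) * (1 / (4 * INR N ^ 2) * cos (phase L N k l i j)))));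
      [intros s; now rewrite Im_dft|].
    apply (Hfam (fun i j s =>
      Re (f s i j) * (- (1 / (4 * INR N ^ 2)) * sin (phase L N k l i j))
      + Im (f s i j) * (1 / (4 * INR N ^ 2) * cos (phase L N k l i j)))).
    intros i j Hij. destruct (H i j Hij) as [Hr Hi].
    apply (is_derive_plus (V := R_NormedModule)); now apply is_derive_mult_const.
Qed.

Lemma dft_continuous (L : R) (N : nat) (f : R -> grid_fun) (t : R) (k l : Z) :
  (forall i j, on_grid N i j -> continuous (fun s => f s i j) t) ->
  continuous (fun s => Re (dft L N (f s) k l)) t /\
  continuous (fun s => Im (dft L N (f s) k l)) t.
Proof.
  intros H.
  assert (Hfam : forall F : Z -> Z -> R -> R,
    (forall i j, on_grid N i j -> continuous (F i j) t) ->
    continuous (fun s => gsum N (fun i j => F i j s)) t).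
  { intros F HF. refine (gsum_family (fun g _ => continuous g t) _ _ _ N F (fun _ _ => 0) _).
    - intros g h e Hgh. now apply continuous_ext.
    - apply continuous_const.
    - intros g h e e' Hg Hh. exact (continuous_plus g h t Hg Hh).
    - exact HF. }
  assert (Hc : forall i j, on_grid N i j -> forall c c' : R,
    continuous (fun s => Re (f s i j) * c + Im (f s i j) * c') t).
  { intros i j Hij c c'. assert (Hf := H i j Hij).
    apply (continuous_plus (V := R_NormedModule));
      apply (continuous_mult (K := R_AbsRing)); try apply continuous_const.
    - apply (continuous_comp (fun s => f s i j) Re); [exact Hf|].
      apply continuous_fst.
    - apply (continuous_comp (fun s => f s i j) Im); [exact Hf|].
      apply continuous_snd. }
  split.
  - eapply continuous_ext; [intros s; symmetry; apply Re_dft|].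
    apply Hfam with (F := fun i j s => _). intros i j Hij. now apply Hc.
  - eapply continuous_ext; [intros s; symmetry; apply Im_dft|].
    apply Hfam with (F := fun i j s => _). intros i j Hij. now apply Hc.
Qed.

(** A path on [0, b] is extended by its end values, so that continuity on the
    closed interval becomes continuity on the line. *)
Definition clamp (b s : R) : R := Rmax 0 (Rmin b s).

Lemma clamp_id (b s : R) : 0 <= s <= b -> clamp b s = s.
Proof. intros H. unfold clamp. rewrite Rmin_right, Rmax_right by lra. reflexivity. Qed.

Lemma clamp_in (b s : R) : 0 <= b -> 0 <= clamp b s <= b.
Proof.
  intros H. unfold clamp. split; [apply Rmax_l|].
  apply Rmax_lub; [exact H|apply Rmin_l].
Qed.

Lemma continuous_clamp (b : R) (f : R -> C) (t : R) :
  0 <= b -> continuous_on (fun s => 0 <= s <= b) f ->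
  continuous (fun s => f (clamp b s)) t.
Proof.
  intros Hb Hf. unfold continuous.
  apply (filterlim_comp _ _ _ (clamp b) f (locally t)
    (within (fun s => 0 <= s <= b) (locally (clamp b t)))).
  - intros P [e He]. exists e. intros s Hs.
    apply He; [|now apply clamp_in].
    revert Hs. unfold ball. simpl. unfold AbsRing_ball, abs, minus, plus, opp. simpl.
    intros Hs. eapply Rle_lt_trans; [|exact Hs].
    unfold clamp, Rmin. destruct (Rle_dec b s), (Rle_dec b t);
      unfold Rmax; repeat destruct Rle_dec; unfold Rabs; repeat destruct Rcase_abs; lra.
  - apply Hf. now apply clamp_in.
Qed.

(** * The energy inequality *)

Section Step.

Context (L : R) (N : nat) (HL : 0 < L) (HN : (1 <= N)%nat).
Context (eps A tau a : R) (HA : (2 + sqrt 3) / 6 <= A) (Htau : 0 < tau) (Ha : 0 <= a).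

Lemma dft_fNL (s : R) (v w : grid_fun) (k l : Z) :
  dft L N (fNL L N tau s v w) k l
  = (dft L N (fN L N v) k l
     + RtoC (s / tau) * (dft L N (fN L N v) k l - dft L N (fN L N w) k l))%C.
Proof.
  unfold fNL. rewrite dft_additive, dft_scal. do 2 f_equal. apply dft_minus.
Qed.

(** The combination w + A tau^2 Delta^2 w is differentiable, with the
    right-hand side of the scheme as its derivative.  Its Fourier coefficient is
    a fixed multiple of that of w, so the latter is differentiated without
    identifying the derivative of the bilaplacian. *)
Lemma mode_equation (w F : R -> grid_fun) (t : R) (k l : Z) :
  in_band N k l -> a < t < a + tau ->
  solves_on L N eps A tau a (a + tau) w F ->
  let kk := 1 + A * tau ^ 2 * lam L k l ^ 2 in
  is_derive (fun s => Re (dft L N (w s) k l)) t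
    (- (eps ^ 2 * lam L k l ^ 2 * Re (dft L N (w t) k l) + Re (dft L N (F t) k l)) / kk) /\
  is_derive (fun s => Im (dft L N (w s) k l)) t
    (- (eps ^ 2 * lam L k l ^ 2 * Im (dft L N (w t) k l) + Im (dft L N (F t) k l)) / kk).
Proof.
  intros Hkl Ht Hsol kk.
  assert (Hkk : 0 < kk).
  { unfold kk. assert (0 <= A * tau ^ 2 * lam L k l ^ 2); [|lra].
    assert (0 <= sqrt 3) by apply sqrt_pos.
    apply Rmult_le_pos; [apply Rmult_le_pos; [lra|]|]; apply pow2_ge_0. }
  set (H := fun (s : R) (i j : Z) =>
    (w s i j + RtoC (A * tau ^ 2) * bilaplacian L N (w s) i j)%C).
  set (rhs := fun i j : Z =>
    (RtoC (- eps ^ 2) * bilaplacian L N (w t) i j + RtoC (-1) * F t i j)%C).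
  assert (Hd : forall i j, on_grid N i j ->
    is_derive (fun s => Re (H s i j)) t (Re (rhs i j)) /\
    is_derive (fun s => Im (H s i j)) t (Im (rhs i j))).
  { intros i j _. destruct (Hsol t) with (i := i) (j := j) as (d1 & d2 & H1 & H2 & E);
      [lra|].
    apply is_derive_of_upto in H1; [|lra]. apply is_derive_of_upto in H2; [|lra].
    assert (Er : rhs i j = (d1 + RtoC (A * tau ^ 2) * d2)%C).
    { rewrite E. unfold rhs. rewrite !RtoC_opp. ring. }
    rewrite Er. destruct H1 as [H1r H1i], H2 as [H2r H2i]. split.
    - replace (Re (d1 + RtoC (A * tau ^ 2) * d2)%C)
        with (Re d1 + Re d2 * (A * tau ^ 2)) by (unfold Re; simpl; ring).
      apply (is_derive_ext (fun s => Re (w s i j)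
        + Re (bilaplacian L N (w s) i j) * (A * tau ^ 2))).
      + intros s. unfold H, Re. simpl. ring.
      + apply (is_derive_plus (V := R_NormedModule)); [exact H1r|].
        now apply is_derive_mult_const.
    - replace (Im (d1 + RtoC (A * tau ^ 2) * d2)%C)
        with (Im d1 + Im d2 * (A * tau ^ 2)) by (unfold Im; simpl; ring).
      apply (is_derive_ext (fun s => Im (w s i j)
        + Im (bilaplacian L N (w s) i j) * (A * tau ^ 2))).
      + intros s. unfold H, Im. simpl. ring.
      + apply (is_derive_plus (V := R_NormedModule)); [exact H1i|].
        now apply is_derive_mult_const. }
  destruct (dft_is_derive L N H rhs t k l Hd) as [Hr Hi].
  assert (EH : forall s, dft L N (H s) k l = (RtoC kk * dft L N (w s) k l)%C).
  { intros s. unfold H. rewrite dft_additive, dft_scal, dft_bilaplacian by assumption.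
    unfold kk. rewrite RtoC_plus, !RtoC_mult. cring. }
  assert (Erhs : dft L N rhs k l
    = (RtoC (- (eps ^ 2 * lam L k l ^ 2)) * dft L N (w t) k l
       + RtoC (-1) * dft L N (F t) k l)%C).
  { unfold rhs. rewrite dft_additive, !dft_scal, dft_bilaplacian by assumption.
    rewrite !RtoC_opp, !RtoC_mult. cring. }
  rewrite Erhs in Hr, Hi. split.
  - apply (is_derive_ext (fun s => Re (dft L N (H s) k l) * / kk)).
    + intros s. rewrite EH, Re_scal. eq_R. field. lra.
    + apply (is_derive_mult_const _ _ _ (/ kk)) in Hr.
      match goal with |- is_derive _ _ ?x => match type of Hr with is_derive _ _ ?y =>
        replace x with y; [exact Hr|] end end.
      unfold Re, Rdiv. simpl. ring.
  - apply (is_derive_ext (fun s => Im (dft L N (H s) k l) * / kk)).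
    + intros s. rewrite EH, Im_scal. eq_R. field. lra.
    + apply (is_derive_mult_const _ _ _ (/ kk)) in Hi.
      match goal with |- is_derive _ _ ?x => match type of Hi with is_derive _ _ ?y =>
        replace x with y; [exact Hi|] end end.
      unfold Im, Rdiv. simpl. ring.
Qed.

(** f_N is a discrete divergence, so Cauchy-Schwarz in the two directions
    applies to its symbol. *)
Lemma fN_difference_bound (v w : grid_fun) (k l : Z) :
  in_band N k l ->
  Cmod (dft L N (fN L N v) k l - dft L N (fN L N w) k l) ^ 2
  <= lam L k l * (Cmod (dft L N (flux_x L N v) k l - dft L N (flux_x L N w) k l) ^ 2
                  + Cmod (dft L N (flux_y L N v) k l - dft L N (flux_y L N w) k l) ^ 2).
Proof.
  intros H. rewrite !dft_fN by assumption.
  destruct (dft L N (flux_x L N v) k l) as [x1 x2],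
    (dft L N (flux_x L N w) k l) as [x1' x2'],
    (dft L N (flux_y L N v) k l) as [y1 y2],
    (dft L N (flux_y L N w) k l) as [y1' y2'].
  rewrite !Cmod2_alt. unfold lam.
  set (p := wave L k). set (q := wave L l). simpl.
  assert (0 <= (q * (x1 - x1') - p * (y1 - y1')) ^ 2) by apply pow2_ge_0.
  assert (0 <= (q * (x2 - x2') - p * (y2 - y2')) ^ 2) by apply pow2_ge_0.
  lra.
Qed.

Lemma path_mode_decay (w F : R -> grid_fun) (wm : grid_fun) (t : R) (k l : Z) :
  continuous_path L N (a + tau) w ->
  solves_on L N eps A tau a (a + tau) w F ->
  (forall r i j, a < r <= a + tau -> F r i j = fNL L N tau (r - a) (w a) wm i j) ->
  in_band N k l -> a <= t <= a + tau ->
  Cdot (dft L N (fN L N (w a)) k l) (dft L N (w t) k l - dft L N (w a) k l)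
  + eps ^ 2 / 2 * lam L k l ^ 2
    * (Cmod (dft L N (w t) k l) ^ 2 - Cmod (dft L N (w a) k l) ^ 2)
  + lam L k l * Cmod (dft L N (w t) k l - dft L N (w a) k l) ^ 2
  <= 1 / 2 *
     (Cmod (dft L N (flux_x L N (w a)) k l - dft L N (flux_x L N wm) k l) ^ 2
      + Cmod (dft L N (flux_y L N (w a)) k l - dft L N (flux_y L N wm) k l) ^ 2).
Proof.
  intros [_ Hcont] Hsol HF Hkl Ht.
  set (b := a + tau) in *.
  set (gam := Cmod (dft L N (flux_x L N (w a)) k l - dft L N (flux_x L N wm) k l) ^ 2
      + Cmod (dft L N (flux_y L N (w a)) k l - dft L N (flux_y L N wm) k l) ^ 2).
  assert (Hb : 0 <= b) by (unfold b; lra).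
  set (P := dft L N (fN L N (w a)) k l). set (Q := dft L N (fN L N wm) k l).
  set (yr := fun s => Re (dft L N (w (clamp b s)) k l)).
  set (yi := fun s => Im (dft L N (w (clamp b s)) k l)).
  assert (Hloc : forall s, a < s < b -> locally s (fun r => clamp b r = r)).
  { intros s Hs. apply (filter_imp (fun r => a < r < b)).
    - intros r Hr. apply clamp_id. lra.
    - apply open_and; [apply open_gt | apply open_lt | exact Hs]. }
  assert (HFdft : forall s, a < s < b -> dft L N (F s) k l
                  = (P + RtoC ((s - a) / tau) * (P - Q))%C).
  { intros s Hs. unfold P, Q. rewrite <- dft_fNL. apply dft_ext.
    intros i j _. apply HF. lra. }
  assert (Hc : forall s, continuous yr s /\ continuous yi s).
  { intros s. apply (dft_continuous L N (fun r => w (clamp b r))).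
    intros i j _. apply (continuous_clamp b (fun r => w r i j)); auto. }
  assert (H := mode_decay A tau (lam L k l) eps gam a t P Q yr yi HA Htau
    (lam_nonneg L k l)).
  assert (Ea : clamp b a = a) by (apply clamp_id; unfold b; lra).
  assert (Et : clamp b t = t) by (apply clamp_id; lra).
  unfold yr, yi in H. rewrite Ea, Et in H.
  assert (Hgam : 0 <= gam).
  { unfold gam. apply Rplus_le_le_0_compat; apply pow2_ge_0. }
  eapply Rle_trans; [|eapply Rle_trans; [apply H|]].
  - rewrite Cdot_eq, !Cmod2_alt. apply Req_le. unfold Re, Im. simpl. ring.
  - exact Hgam.
  - now apply fN_difference_bound.
  - intros s Hs. destruct (mode_equation w F s k l Hkl Hs Hsol) as [Hr _].
    rewrite HFdft in Hr by exact Hs.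
    apply (is_derive_ext_loc (fun r => Re (dft L N (w r) k l))).
    + apply (filter_imp (fun r => clamp b r = r)); [|now apply Hloc].
      intros r ->. reflexivity.
    + rewrite (clamp_id b s) by (unfold b in *; lra).
      match goal with |- is_derive _ _ ?x => match type of Hr with is_derive _ _ ?y =>
        replace x with y; [exact Hr|] end end.
      f_equal. unfold Re. simpl. ring.
  - intros s Hs. destruct (mode_equation w F s k l Hkl Hs Hsol) as [_ Hi].
    rewrite HFdft in Hi by exact Hs.
    apply (is_derive_ext_loc (fun r => Im (dft L N (w r) k l))).
    + apply (filter_imp (fun r => clamp b r = r)); [|now apply Hloc].
      intros r ->. reflexivity.
    + rewrite (clamp_id b s) by (unfold b in *; lra).
      match goal with |- is_derive _ _ ?x => match type of Hi with is_derive _ _ ?y =>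
        replace x with y; [exact Hi|] end end.
      f_equal. unfold Im. simpl. ring.
  - intros s. exact (proj1 (Hc s)).
  - intros s. exact (proj2 (Hc s)).
  - exact Ht.
  - apply Req_le. field.
Qed.

Theorem step_energy (w F : R -> grid_fun) (wm : grid_fun) (t : R) :
  continuous_path L N (a + tau) w ->
  solves_on L N eps A tau a (a + tau) w F ->
  (forall r i j, a < r <= a + tau -> F r i j = fNL L N tau (r - a) (w a) wm i j) ->
  a <= t <= a + tau ->
  energy L N eps (w t) + 1 / 2 * grad_dist2 L N (w t) (w a)
  <= energy L N eps (w a) + 1 / 2 * grad_dist2 L N (w a) wm.
Proof.
  intros Hcont Hsol HF Ht.
  assert (HE := energy_tangent L N HL HN eps (w a) (w t)).
  assert (HD := grad_dist2_dft L N HL HN (w t) (w a)).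
  assert (HG := flux_lipschitz L N HL HN (w a) wm).
  assert (HS : fsum N (fun k l =>
      Cdot (dft L N (fN L N (w a)) k l) (dft L N (w t) k l - dft L N (w a) k l)
      + eps ^ 2 / 2 * lam L k l ^ 2
        * (Cmod (dft L N (w t) k l) ^ 2 - Cmod (dft L N (w a) k l) ^ 2))
    + fsum N (fun k l => lam L k l * Cmod (dft L N (w t) k l - dft L N (w a) k l) ^ 2)
    <= 1 / 2 * fsum N (fun k l =>
      Cmod (dft L N (flux_x L N (w a)) k l - dft L N (flux_x L N wm) k l) ^ 2
      + Cmod (dft L N (flux_y L N (w a)) k l - dft L N (flux_y L N wm) k l) ^ 2)).
  { rewrite <- fsum_Rmult_l, <- fsum_Rplus. apply fsum_le; intros k l Hkl.
    now apply (path_mode_decay w F wm t k l). }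
  apply (Rmult_le_compat_l (L ^ 2)) in HS; [|apply pow2_ge_0].
  rewrite Rmult_plus_distr_l, <- HD in HS. simpl in *. lra.
Qed.

End Step.

(** Induction over the steps.  The middle estimate carries the gradient
    increment that the next step consumes; the last one is needed at every
    earlier time because the norm bound is asserted on all of [0, t_(n+1)]. *)
Lemma sETDMs2_bounds (L eps T A : R) (N Nt : nat) (u0 : grid_fun)
    (u : nat -> R -> grid_fun) :
  0 < L -> 0 < eps -> 0 < T -> (1 <= N)%nat -> (1 <= Nt)%nat ->
  (2 + sqrt 3) / 6 <= A ->
  sETDMs2 L N eps A T Nt u0 u ->
  forall n : nat, (n < Nt)%nat ->
  let tn := INR n * (T / INR Nt) in
  let tS := INR (S n) * (T / INR Nt) in
  u (S n) tn = u n tn /\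
  energy L N eps (u (S n) tS) + 1 / 2 * grad_dist2 L N (u (S n) tS) (u n tn)
  <= energy L N eps u0 /\
  (forall t, 0 <= t <= tS ->
     mean_zero_grid L N (u (S n) t) /\
     energy L N eps (u (S n) t) <= energy L N eps u0).
Proof.
  intros HL He HT HN HNt HA (Hmz & Hu0 & (Hc1 & Hi1 & Hs1) & Hstep).
  set (tau := T / INR Nt) in *.
  assert (Htau : 0 < tau) by (apply Rdiv_lt_0_compat; [exact HT|]; apply lt_0_INR; lia).
  assert (HSt : forall n, INR (S n) * tau = INR n * tau + tau)
    by (intros n; rewrite S_INR; ring).
  assert (Htn : forall n, 0 <= INR n * tau)
    by (intros n; apply Rmult_le_pos; [apply pos_INR | lra]).
  (* The initial step is a general step whose two previous values coincide. *)
  assert (Hfirst : forall r i j, 0 < r <= 0 + tau ->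
    fN L N u0 i j = fNL L N tau (r - 0) (u 1%nat 0) u0 i j).
  { intros r i j _. rewrite Hi1. unfold fNL. ring. }
  induction n as [|n IH]; intros Hn tn tS.
  - assert (Etn : tn = 0) by (unfold tn; simpl; ring).
    assert (EtS : tS = 0 + tau) by (unfold tS; simpl; ring).
    assert (Hu00 : u 0%nat tn = u0) by exact Hu0.
    change (INR 1 * tau) with tS in Hc1, Hs1. rewrite EtS in Hc1, Hs1.
    assert (HE := fun t => step_energy L N HL HN eps A tau 0 HA Htau (Rle_refl 0)
       (u 1%nat) (fun _ => fN L N u0) u0 t Hc1 Hs1 Hfirst).
    rewrite Hi1, (grad_dist2_refl L N HL HN) in HE.
    rewrite Hu00, Etn, EtS. split; [exact Hi1|split].
    + assert (H := HE (0 + tau)). lra.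
    + intros t Ht. split; [now apply Hc1|].
      assert (H := HE t Ht). assert (H' := grad_dist2_nonneg L N (u 1%nat t) u0). lra.
  - destruct (IH ltac:(lia)) as (Hmatch & HEn & Hall).
    destruct (Hstep (S n) ltac:(lia)) as (Hc & Hag & Hs).
    replace (S n - 1)%nat with n in Hs by lia.
    fold tn tS in Hc, Hag, Hs, HEn, Hall.
    assert (EtS : tS = tn + tau) by (unfold tS, tn; apply HSt).
    assert (Hwa : u (S (S n)) tn = u (S n) tn) by (apply Hag; split; [apply Htn|lra]).
    rewrite EtS in Hc, Hs.
    assert (HE := fun t => step_energy L N HL HN eps A tau tn HA Htau (Htn (S n))
       (u (S (S n))) _ (u n (INR n * tau)) t Hc Hs).
    rewrite Hwa in HE.
    assert (HE' := fun t => HE t (fun r i j _ => eq_refl)). clear HE.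
    split; [exact Hwa|]. rewrite EtS. split.
    + assert (H := HE' (tn + tau)). lra.
    + intros t Ht. split; [now apply Hc|].
      destruct (Rle_lt_dec t tn) as [Hle|Hlt].
      * rewrite Hag by lra. apply Hall. lra.
      * assert (H := HE' t ltac:(lra)).
        assert (H' := grad_dist2_nonneg L N (u (S (S n)) t) (u (S n) tn)). lra.
Qed.

Theorem proposition3p3 :
  exists C1 : R -> R -> R -> R,
  forall (L eps T A : R) (N Nt : nat) (u0 : grid_fun) (u : nat -> R -> grid_fun),
    0 < L -> 0 < eps -> 0 < T -> (1 <= N)%nat -> (1 <= Nt)%nat ->
    (2 + sqrt 3) / 6 <= A ->
    sETDMs2 L N eps A T Nt u0 u ->
    forall n : nat, (n <= Nt - 1)%nat ->
      energy L N eps (u (S n) (INR (S n) * (T / INR Nt))) <= energy L N eps u0 /\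
      (forall t : R, 0 <= t <= INR (S n) * (T / INR Nt) ->
         normH2 L N (u (S n) t) ^ 2 <= C1 eps L (normH2 L N u0)).
Proof.
  exists H2_bound.
  intros L eps T A N Nt u0 u HL He HT HN HNt HA Hu n Hn.
  destruct (sETDMs2_bounds L eps T A N Nt u0 u HL He HT HN HNt HA Hu n ltac:(lia))
    as (_ & _ & Hall).
  split.
  - apply Hall. split; [|apply Rle_refl].
    apply Rmult_le_pos; [apply pos_INR|]. left.
    apply Rdiv_lt_0_compat; [exact HT|]. apply lt_0_INR. lia.
  - intros t Ht. destruct (Hall t Ht) as [Hmz HE].
    now apply (normH2_le_of_energy_le L N HL HN eps).
Qed.
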